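(* There exists an increasing chain of groups ${}^{1}G\leq {}^{2}G\leq \cdots \leq {}^{k-1}G\leq {}^{k}G\leq\cdots$ (indexed by the integers $k\geq 1$) such that: (i) ${}^{1}G$ is a nonabelian countable free group; (ii) each ${}^{k}G$ is a torsion-free $CSA$-group in which maximal abelian subgroups are cyclic; (iii) for each $k\geq 2$, any two maximal abelian subgroups of ${}^{k-1}G$ are conjugate in ${}^{k}G$, and each element of ${}^{k-1}G$ has a $k$-th root in ${}^{k}G$; and the union $G=\bigcup_{k\geq 1}{}^{k}G$ is a torsion-free nonabelian $CSA$-group in which any two maximal abelian subgroups are conjugate and every maximal abelian subgroup is divisible.
   Context: A $CSA$-group is a group $\Gamma$ in which every maximal abelian subgroup $A$ is malnormal, i.e. for every $g\in\Gamma$, $A\cap A^{g}\neq 1$ implies $g\in A$, where $A^{g}=g^{-1}Ag$. An abelian group $A$ is divisible if for every integer $n\geq 1$ every element of $A$ has an $n$-th root in $A$. *)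

(* Defs.v *)
From HB Require Import structures.
From mathcomp Require Import all_boot.
From mathcomp Require Import boolp classical_sets functions cardinality.

Set Implicit Arguments.
Unset Strict Implicit.
Unset Printing Implicit Defensive.

Import Algebra.

Local Open Scope classical_set_scope.
Local Open Scope group_scope.

(* Groups are possibly infinite [groupType]s. Every notion below is stated for
   a subset [H] of an ambient group [G] and is meant for subgroups [H]; the
   group [G] itself is [[set: G]]. *)

Definition is_subgroup (G : groupType) (H : set G) : Prop :=
  group_closed (mem H).

Definition is_abelian (G : groupType) (H : set G) : Prop :=
  {in H &, forall x y, x * y = y * x}.

Definition torsion_free (G : groupType) (H : set G) : Prop :=
  {in H, forall x n, (1 <= n)%N -> x ^+ n = 1 -> x = 1}.

(* Recall that [x ^ g] is [g^-1 * (x * g)]. *)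
Definition conj_set (G : groupType) (A : set G) (g : G) : set G :=
  [set x ^ g | x in A].

Definition max_abelian (G : groupType) (H A : set G) : Prop :=
  [/\ is_subgroup A, is_abelian A, A `<=` H &
      forall B : set G, is_subgroup B -> is_abelian B -> B `<=` H ->
        A `<=` B -> B = A].

Definition malnormal (G : groupType) (H A : set G) : Prop :=
  {in H, forall g, A `&` conj_set A g <> [set 1] -> g \in A}.

Definition CSA (G : groupType) (H : set G) : Prop :=
  forall A : set G, max_abelian H A -> malnormal H A.

Definition is_cyclic (G : groupType) (A : set G) : Prop :=
  exists a : G, A = [set x | exists n : nat, x = a ^+ n \/ x = (a ^+ n)^-1].

Definition divisible (G : groupType) (A : set G) : Prop :=
  forall n, (1 <= n)%N -> {in A, forall x, exists2 y, y \in A & y ^+ n = x}.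

Definition conjugate_in (G : groupType) (K A B : set G) : Prop :=
  exists2 g, g \in K & B = conj_set A g.

(* The universal property: every map from the basis [X] to a group [L] extends
   uniquely to a homomorphism [H -> L]. Maps from [X] or [H] are represented by
   total functions on [G], of which only the values on [X], resp. [H], matter. *)
Definition free_basis (G : groupType) (H X : set G) : Prop :=
  X `<=` H /\
  forall (L : groupType) (f : G -> L),
    (exists phi : G -> L,
       {in H &, {morph phi : x y / x * y}} /\ {in X, phi =1 f}) /\
    (forall phi psi : G -> L,
       {in H &, {morph phi : x y / x * y}} -> {in X, phi =1 f} ->
       {in H &, {morph psi : x y / x * y}} -> {in X, psi =1 f} ->
       {in H, phi =1 psi}).

Definition is_free (G : groupType) (H : set G) : Prop :=
  exists X : set G, free_basis H X.

(* Main.v *)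
Require Import Defs.
From HB Require Import structures.
From mathcomp Require Import all_boot perm generic_quotient.
From mathcomp Require Import order ssralg ssrnum ssrint intdiv zify.
From mathcomp Require Import boolp classical_sets functions cardinality.

(* Call a torsion-free group good if each nontrivial element lies in a malnormal
   cyclic subgroup. To pass from a good group [A] to the next one, take one
   malnormal cyclic subgroup <b_i> per conjugacy class, add one new vertex with
   group Z = <c>, and form the fundamental group of the graph of groups in which
   the edge [i] glues b_i to c^k. Then every b_i becomes conjugate to the
   k-th power of c, which gives both conjugacy and k-th roots.

   The new group is good by its action on the Bass-Serre tree. At a vertex of type
   A the edges are the malnormal cyclic subgroups of its stabilizer, so a nontrivial
   element fixing that vertex fixes exactly one edge there; hence a nontrivial
   elliptic element fixes exactly one vertex of type Z, whose stabilizer is an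
   infinite cyclic malnormal subgroup. A hyperbolic element has an axis; only the
   identity fixes a line pointwise and a reflection of it would have order 2, so
   the stabilizer of the axis is again infinite cyclic and malnormal.

   The free group of rank 2 is the same construction on trivial groups with three
   edges. In the union, goodness of the stages gives that commutation is transitive
   on nontrivial elements, so maximal abelian subgroups are centralizers; the rest
   is read off at a finite stage. *)

Set Implicit Arguments.
Unset Strict Implicit.
Unset Printing Implicit Defensive.

Local Open Scope classical_set_scope.
Local Open Scope group_scope.

(** * Integer powers and malnormal cyclic subgroups *)

Definition zpow (G : groupType) (x : G) (n : int) : G :=
  match n with Posz m => x ^+ m | Negz m => x ^- m.+1 end.

Section IntegerPowers.
Variable G : groupType.
Implicit Types (x y g : G) (m n : int).

Lemma zpow0 x : zpow x 0%R = 1. Proof. by []. Qed.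

Lemma zpow1 x : zpow x 1%R = x. Proof. by []. Qed.

Lemma zpow1n n : zpow (1 : G) n = 1.
Proof. by case: n => n /=; rewrite expg1n ?invg1. Qed.

Lemma zpowS x n : zpow x (n + 1)%R = zpow x n * x.
Proof.
case: n => [n|[|n]].
- by rewrite (_ : (Posz n + 1)%R = Posz n.+1) /= ?expgSr //; lia.
- by rewrite (_ : (Negz 0 + 1)%R = Posz 0) //= expg1 mulVg.
- rewrite (_ : (Negz n.+1 + 1)%R = Negz n) /=; last by lia.
  by rewrite [x ^+ n.+2]expgS invgM mulgVK.
Qed.

Lemma zpowD x m n : zpow x (m + n)%R = zpow x m * zpow x n.
Proof.
elim/int_rect: n => [|n IH|n IH]; first by rewrite GRing.addr0 mulg1.
- by rewrite (_ : (m + n.+1)%R = (m + n + 1)%R) ?zpowS ?IH; last lia;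
     rewrite (_ : Posz n.+1 = (n%:Z + 1)%R) ?zpowS ?mulgA //; lia.
- apply: (mulIg x); rewrite -zpowS -mulgA -zpowS.
  rewrite (_ : (m - n.+1%:Z + 1)%R = (m - n%:Z)%R); last by lia.
  by rewrite (_ : (- n.+1%:Z + 1)%R = (- n%:Z)%R) //; lia.
Qed.

Lemma zpowN x n : zpow x (- n)%R = (zpow x n)^-1.
Proof. by apply: (mulIg (zpow x n)); rewrite mulVg -zpowD GRing.addNr. Qed.

Lemma zpow_comm x m n : zpow x m * zpow x n = zpow x n * zpow x m.
Proof. by rewrite -!zpowD GRing.addrC. Qed.

Lemma zpowM x m n : zpow x (m * n)%R = zpow (zpow x m) n.
Proof.
elim/int_rect: n => [|n IH|n IH]; first by rewrite GRing.mulr0.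
- rewrite (_ : (m * n.+1)%R = (m * n + m)%R) ?zpowD ?IH; last by lia.
  by rewrite (_ : Posz n.+1 = (n%:Z + 1)%R) ?zpowS //; lia.
- rewrite (_ : (m * - n.+1%:Z)%R = (m * - n%:Z - m)%R); last by lia.
  rewrite (_ : (- n.+1%:Z)%R = (- n%:Z - 1)%R); last by lia.
  by rewrite !zpowD IH !zpowN zpow1.
Qed.

Lemma zpowJ x g n : zpow x n ^ g = zpow (x ^ g) n.
Proof. by case: n => n /=; rewrite ?conjVg conjXg. Qed.

End IntegerPowers.

Lemma morph1 (G H : groupType) (f : G -> H) :
  {morph f : x y / x * y} -> f 1 = 1.
Proof. by move=> fM; apply: (mulIg (f 1)); rewrite -fM !mul1g. Qed.

Lemma morphV (G H : groupType) (f : G -> H) :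
  {morph f : x y / x * y} -> {morph f : x / x^-1}.
Proof. by move=> fM x; apply: (mulIg (f x)); rewrite -fM !mulVg (morph1 fM). Qed.

Lemma morphJ (G H : groupType) (f : G -> H) :
  {morph f : x y / x * y} -> {morph f : x y / x ^ y}.
Proof. by move=> fM x y; rewrite !conjgE !fM (morphV fM). Qed.

Lemma morph_zpow (G H : groupType) (f : G -> H) :
  {morph f : x y / x * y} -> forall x n, f (zpow x n) = zpow (f x) n.
Proof.
move=> fM x n; have fX k : f (x ^+ k) = f x ^+ k.
  by elim: k => [|k IH]; rewrite ?(morph1 fM) // !expgS fM IH.
by case: n => n /=; rewrite -?fX // morphV.
Qed.

Definition powers (G : groupType) (a : G) : set G :=
  [set x | exists n, x = zpow a n].

Lemma powers_cyclic (G : groupType) (a : G) : is_cyclic (powers a).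
Proof.
exists a; apply/seteqP; split=> x /=.
  by case=> -[] n ->; [exists n; left | exists n.+1; right].
case=> n [->|->]; first by exists n.
by exists (- n%:Z)%R; rewrite zpowN.
Qed.

Definition torsionless (G : groupType) : Prop :=
  forall (x : G) n, x ^+ n.+1 = 1 -> x = 1.

Lemma torsionless_zpow (G : groupType) (x : G) n :
  torsionless G -> n != 0%R -> zpow x n = 1 -> x = 1.
Proof.
move=> tf; case: n => [[|n]|n] //= _; first exact: tf.
by move=> e; apply: (tf _ n); rewrite -[LHS]invgK e invg1.
Qed.

Lemma torsionless_zpow_inj (G : groupType) (x : G) :
  torsionless G -> x <> 1 -> injective (zpow x).
Proof.
move=> tf x1 m n e; apply/eqP/negPn/negP => mn; apply: x1.
apply: (@torsionless_zpow _ _ (m - n)%R) => //; first by lia.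
by rewrite zpowD zpowN e mulgV.
Qed.

(** Malnormality of the subgroup generated by [a], elementwise. It holds vacuously for [a = 1],
    which is why [a <> 1] is carried along separately later. *)
Definition powers_malnormal (G : groupType) (a : G) : Prop :=
  forall g y, y <> 1 -> powers a y -> powers a (y ^ g) -> powers a g.

(* For a nontrivial group this amounts to being a torsion-free CSA-group whose
   maximal abelian subgroups are cyclic. *)
Definition cyclic_CSA (G : groupType) : Prop :=
  torsionless G /\
  forall x : G, x <> 1 -> exists2 a, powers a x & powers_malnormal a.

(** * Group actions on trees *)

Section Trees.
Local Open Scope nat_scope.
(** A tree is presented as a rooted one: neighbours differ in height by one, and each vertex of
    positive height has exactly one lower neighbour, its parent. *)
Variables (V : Type) (adj : V -> V -> Prop) (h : V -> nat).
Hypothesis adj_sym : forall u v, adj u v -> adj v u.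
Hypothesis adj_height : forall u v, adj u v -> h u = (h v).+1 \/ h v = (h u).+1.
Hypothesis parent_uniq : forall u v w,
  adj u v -> adj u w -> h v < h u -> h w < h u -> v = w.
Hypothesis parent_ex : forall u, 0 < h u -> exists2 v, adj u v & h v < h u.
Hypothesis root_uniq : forall u v, h u = 0 -> h v = 0 -> u = v.

(** * Reduced paths *)

Definition reduced_path n (p : nat -> V) :=
  (forall i, i < n -> adj (p i) (p i.+1)) /\
  (forall i, i.+1 < n -> p i <> p i.+2).

Lemma reduced_path_shift n p k m : reduced_path n p -> k + m <= n ->
  reduced_path m (fun i => p (k + i)).
Proof.
by case=> pa pr km; split=> i im /=; rewrite !addnS; [apply: pa | apply: pr]; lia.
Qed.

Lemma reduced_path_rev n p : reduced_path n p ->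
  reduced_path n (fun i => p (n - i)).
Proof.
case=> pa pr; split=> i im /=.
  by apply: adj_sym; rewrite (_ : n - i = (n - i.+1).+1); [apply: pa; lia | lia].
rewrite (_ : n - i = (n - i.+2).+2); last by lia.
by move=> e; apply: (pr (n - i.+2)); first lia.
Qed.

Lemma reduced_path_cat n m p q : reduced_path n p -> reduced_path m q ->
    p n = q 0 -> (0 < n -> 0 < m -> p n.-1 <> q 1) ->
  reduced_path (n + m) (fun i => if i <= n then p i else q (i - n)).
Proof.
case=> pa pr [qa qr] e c; split=> i im /=.
  case: (ltngtP i n) => [||ni]; [exact: pa| |].
  - by move=> ni; rewrite subSn ?(ltnW ni) //; apply: qa; lia.
  - by rewrite ni e subSn // subnn; apply: qa; lia.
case: (ltngtP i.+1 n) => [lt|gt|ei].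
- by rewrite (ltnW (ltnW lt)); apply: pr.
- rewrite (_ : i.+2 - n = (i - n).+2); last by lia.
  case: (ltnP n i) => [_|ni]; first by apply: qr; lia.
  have -> : i = n by lia.
  by rewrite e subnn; apply: qr; lia.
- move: c; rewrite -ei leqnSn subSn // subnn /=; apply; lia.
Qed.

(** If a vertex of maximal height is interior, both its neighbours are its parent, against
    reducedness. If the maximum is at the ends of a closed path, the second and the last but one
    vertex are both the parent of the common end, and cutting off the ends leaves a shorter closed
    reduced path. *)
Lemma reduced_path_acyclic n p : 0 < n -> reduced_path n p -> p 0 <> p n.
Proof.
elim/ltn_ind: n p => n IH p n0 [pa pr] e.
pose i := [arg max_(i > ord0 : 'I_n.+1) h (p i)].
have imax j : j <= n -> h (p j) <= h (p i).
  rewrite /i; case: arg_maxnP => // k _ km jn.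
  by apply: (km (Ordinal (jn : j < n.+1))).
have low u v : adj u v -> h v <= h u -> h v < h u by move/adj_height; lia.
have n2 : 1 < n.
  case: n n0 {IH pr i imax} pa e => [|[|n]] // _ pa e.
  by have := adj_height (pa 0 isT); rewrite e; lia.
case: (boolP (0 < i < n)) => [/andP[i0 iN]|].
  have := pr i.-1; rewrite prednK // => /(_ iN); apply.
  apply: (@parent_uniq (p i)).
  - by apply: adj_sym; rewrite -{2}(prednK i0); apply: pa; lia.
  - exact: pa.
  - apply: low; last by apply: imax; lia.
    by apply: adj_sym; rewrite -{2}(prednK i0); apply: pa; lia.
  - by apply: low; [apply: pa | apply: imax].
rewrite negb_and => iend.
have hi : h (p i) = h (p 0).
  have [->|->] : nat_of_ord i = 0 \/ nat_of_ord i = n by have := ltn_ord i; lia.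
    by [].
  by rewrite e.
have a1 : adj (p 0) (p 1) by apply: pa; lia.
have an : adj (p 0) (p n.-1).
  by apply: adj_sym; rewrite e -{2}(prednK n0); apply: pa; lia.
have e1 : p 1 = p n.-1.
  apply: (@parent_uniq (p 0)) => //; apply: low => //; rewrite -hi; apply: imax; lia.
have [n3|n3] : n = 2 \/ 2 < n by lia.
  by apply: (pr 0) => //; rewrite e n3.
apply: (IH (n - 2) _ (fun k => p (1 + k))); rewrite ?addn0.
- by lia.
- by lia.
- by apply: (@reduced_path_shift n) => //; lia.
- by rewrite e1; congr (p _); lia.
Qed.

(** Drop the common initial part; where the paths diverge, the reverse of [p] followed by [q] is a
    closed reduced path. *)
Lemma reduced_path_uniq n m p q : reduced_path n p -> reduced_path m q ->
  p 0 = q 0 -> p n = q m -> n = m /\ forall i, i <= n -> p i = q i.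
Proof.
elim: n m p q => [|n IH] [|m] p q pP qP e0 en.
- by split=> // i; rewrite leqn0 => /eqP->.
- by case: (reduced_path_acyclic (ltn0Sn m) qP); rewrite -e0 en.
- by case: (reduced_path_acyclic (ltn0Sn n) pP); rewrite e0 en.
have [e1|n1] := EM (p 1 = q 1).
  have [| | |/= -> e] := IH m (fun i => p (1 + i)) (fun i => q (1 + i)) _ _ e1.
  - by apply: reduced_path_shift pP _.
  - by apply: reduced_path_shift qP _.
  - by rewrite !add1n.
  by split=> // -[|i] // /e.
exfalso.
apply: (@reduced_path_acyclic (n.+1 + m.+1)
  (fun i => if i <= n.+1 then p (n.+1 - i) else q (i - n.+1))).
- by [].
- apply: reduced_path_cat => //=; first exact: reduced_path_rev.
    by rewrite subnn.
  by move=> _ _; rewrite subSn // subnn.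
- by rewrite leq0n ifF ?subn0 ?addKn //; lia.
Qed.

Definition connected u v :=
  exists n, exists2 p, reduced_path n p & p 0 = u /\ p n = v.

Lemma connected_refl u : connected u u.
Proof. by exists 0, (fun=> u); split. Qed.

Lemma connected_sym u v : connected u v -> connected v u.
Proof.
case=> n [p pP [<- <-]]; exists n, (fun i => p (n - i)).
  exact: reduced_path_rev.
by rewrite subn0 subnn.
Qed.

Lemma connected_step u w v : adj u w -> connected w v -> connected u v.
Proof.
move=> uw [n [p pP [p0 pn]]].
have [[n0 e]|ne] := EM (0 < n /\ p 1 = u).
  exists n.-1, (fun i => p (1 + i)); first by apply: reduced_path_shift pP _; lia.
  by split=> //; rewrite -pn; congr p; lia.
exists n.+1, (fun i => if i is j.+1 then p j else u) => //.
case: pP => pa pr; split=> [] [|i] //= im.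
- by rewrite p0.
- exact: pa.
- by move=> e; apply: ne.
- exact: pr.
Qed.

Lemma tree_connected u v : connected u v.
Proof.
have toroot w r : h r = 0 -> connected w r.
  move: {2}(h w) (leqnn (h w)) => n; elim: n w => [|n IH] w hw r0.
    have -> : w = r by apply: root_uniq => //; lia.
    exact: connected_refl.
  have [w0|/parent_ex[x wx hx]] := posnP (h w).
    by have -> : w = r by [apply: root_uniq]; exact: connected_refl.
  by apply: connected_step wx _; apply: IH => //; lia.
move: {2}(h u) (leqnn (h u)) => n; elim: n u => [|n IH] u hu.
  by apply: connected_sym; apply: toroot; lia.
have [u0|/parent_ex[x wx hx]] := posnP (h u).
  exact/connected_sym/toroot.
by apply: connected_step wx _; apply: IH; lia.
Qed.

(** * Bi-infinite reduced paths *)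

Definition line (f : int -> V) :=
  (forall i, adj (f i) (f (i + 1)%R)) /\ (forall i, f i <> f (i + 2)%R).

Lemma line_segment f a n : line f ->
  reduced_path n (fun k => f (a + k%:Z)%R).
Proof.
case=> fa fr; split=> i _.
  by rewrite (_ : (a + i.+1)%R = (a + i%:Z + 1)%R) //; lia.
by rewrite (_ : (a + i.+2)%R = (a + i%:Z + 2)%R) //; lia.
Qed.

Lemma line_inj f : line f -> injective f.
Proof.
move=> fL; suff lt i j : (i < j)%R -> f i <> f j.
  move=> i j e; have [] : (i < j)%R \/ (j < i)%R \/ i = j by lia.
    by move/lt.
  by case=> // /lt; rewrite e.
move=> ij; have := @reduced_path_acyclic `|(j - i)%R| _ _ (@line_segment f i _ fL).
rewrite (_ : (i + 0%:Z)%R = i); last by lia.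
by rewrite (_ : (i + `|(j - i)%R|)%R = j); [apply; lia | lia].
Qed.

Lemma line_rev f : line f -> line (fun i => f (- i)%R).
Proof.
case=> fa fr; split=> i.
  apply: adj_sym; rewrite (_ : (- i)%R = (- (i + 1) + 1)%R) //; lia.
move=> e; apply: (fr (- (i + 2))%R); rewrite -e; congr f; lia.
Qed.

(** * Translations, axes and stabilizers *)

Section Actions.
Variables (Gam : groupType) (act : Gam -> V -> V).
Hypothesis act1 : forall v, act 1%g v = v.
Hypothesis actM : forall x y v, act (x * y)%g v = act x (act y v).
Hypothesis act_adj : forall x u v, adj u v -> adj (act x u) (act x v).

Lemma actK x : cancel (act x) (act x^-1).
Proof. by move=> v; rewrite -actM mulVg act1. Qed.

Lemma act_inj x : injective (act x).
Proof. exact: can_inj (@actK x). Qed.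

Lemma act_path x n p : reduced_path n p -> reduced_path n (fun i => act x (p i)).
Proof.
by case=> pa pr; split=> i im; [apply/act_adj/pa | move/act_inj; apply: pr].
Qed.

Lemma act_line x f : line f -> line (fun i => act x (f i)).
Proof. by case=> fa fr; split=> i; [apply: act_adj | move/act_inj/fr]. Qed.

Definition translates x (f : int -> V) (p : int) := forall i, act x (f i) = f (i + p)%R.

Lemma translates_zpow x f p n :
  translates x f p -> translates (zpow x n) f (p * n)%R.
Proof.
move=> xf; elim/int_rect: n => [|n IH|n IH] i.
- by rewrite zpow0 act1 GRing.mulr0 GRing.addr0.
- rewrite (_ : Posz n.+1 = (n%:Z + 1)%R); last by lia.
  by rewrite zpowS actM xf IH; congr f; lia.
- rewrite (_ : (- n.+1%:Z)%R = (- n%:Z - 1)%R); last by lia.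
  rewrite zpowD actM (zpowN x 1%R) zpow1 -{1}(GRing.subrK p i) -xf actK IH; congr f; lia.
Qed.

Lemma translatesV x f p : translates x f p -> translates x^-1 f (- p)%R.
Proof. by move=> xf i; rewrite -{1}(GRing.subrK p i) -xf actK. Qed.

Lemma translatesM x y f p q :
  translates x f p -> translates y f q -> translates (x * y)%g f (p + q)%R.
Proof. by move=> xf yf i; rewrite actM yf xf; congr f; lia. Qed.

(** If the lines meet, they also meet at all translates of the meeting point under powers of [y],
    and uniqueness of reduced paths makes them agree in between. If they are disjoint, a bridge
    between them yields a second reduced path from a point of [f] to its image. *)
Lemma common_axis_pos y f f' p q : line f -> line f' ->
    translates y f p -> translates y f' q -> (0 < p)%R -> (0 < q)%R ->
  exists s, forall i, f' i = f (i + s)%R.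
Proof.
move=> fL f'L yf yf' p0 q0.
have [[i0 [j0 e0]]|disj] := EM (exists i j, f i = f' j).
  have meet (k : int) : f (i0 + p * k)%R = f' (j0 + q * k)%R.
    by rewrite -(translates_zpow k yf) -(translates_zpow k yf') e0.
  have pq : p = q.
    have [] := @reduced_path_uniq `|p| `|q| (fun k => f (i0 + k%:Z)%R)
                  (fun k => f' (j0 + k%:Z)%R).
    - exact: line_segment.
    - exact: line_segment.
    - by rewrite !GRing.addr0.
    - have := meet 1%R; rewrite !GRing.mulr1 => m1.
      by rewrite !gez0_abs ?m1 //; lia.
    - by lia.
  rewrite -{q q0 yf'}pq in meet.
  exists (i0 - j0)%R => i.
  (* [k] is so large that the segment reaching from [P] steps before to [P] steps after the meeting
     point contains [f' i]. *)
  pose k := `|(i - j0)%R|; have kp : (k%:Z <= p * k%:Z)%R by nia.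
  set P := (p * k%:Z)%R in kp.
  have [||||_ /(_ `|(i - j0 + P)%R|)] := @reduced_path_uniq `|(P + P)%R| `|(P + P)%R|
    (fun t => f (i0 - P + t%:Z)%R) (fun t => f' (j0 - P + t%:Z)%R).
  - exact: line_segment.
  - exact: line_segment.
  - by have := meet (- k%:Z)%R; rewrite !GRing.mulrN !GRing.addr0.
  - have := meet (Posz k); rewrite -/P => mk.
    by rewrite gez0_abs; [rewrite !GRing.addrA !GRing.subrK | lia].
  rewrite gez0_abs; last by lia.
  rewrite (_ : (i0 - P + (i - j0 + P))%R = (i + (i0 - j0))%R); last by lia.
  rewrite (_ : (j0 - P + (i - j0 + P))%R = i); last by lia.
  by move=> ->; last lia.
exfalso.
(* Let [r] be a shortest bridge. Then [r], a period of [f'] and the reverse of the image of [r]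
   under [y] form a reduced path with both ends on [f]; it must run inside [f], but [r 1] is off [f]
   by minimality. *)
pose joined n := `[< exists i j r, [/\ reduced_path n r, r 0 = f i & r n = f' j] >].
have /ex_minnP[n /asboolP[i [j [r [rP r0 rn]]]] nmin] : exists n, joined n.
  have [n [r rP [r0 rn]]] := tree_connected (f 0%R) (f' 0%R).
  by exists n; apply/asboolP; exists 0%R, 0%R, r.
have n0 : 0 < n.
  by rewrite lt0n; apply/eqP => n0; apply: disj; exists i, j; rewrite -r0 -rn n0.
have off i' : r 1 <> f i'.
  move=> e; have : n <= n.-1; last by lia.
  apply: nmin; apply/asboolP; exists i', j, (fun k => r (1 + k)).
  split=> //; first by apply: reduced_path_shift rP _; lia.
  by rewrite -rn; congr r; lia.
have off' j' : r n.-1 <> f' j'.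
  move=> e; have : n <= n.-1; last by lia.
  apply: nmin; apply/asboolP; exists i, j', (fun k => r (0 + k)).
  by split=> //; apply: reduced_path_shift rP _; lia.
have R1 := reduced_path_cat rP (@line_segment f' j `|q| f'L).
have {}R1 := R1 _ _; rewrite GRing.addr0 in R1.
have {}R1 := R1 rn (fun _ _ => @off' _).
have R2 := reduced_path_cat R1 (reduced_path_rev (act_path y rP)).
have [||||_] := reduced_path_uniq (R2 _ _) (@line_segment f i `|p| fL).
- rewrite ifF; last by lia.
  by rewrite subn0 rn yf'; congr f'; lia.
- move=> _ _; rewrite (_ : (if _ then _ else _) = f' (j - 1 + q)%R).
    by rewrite -yf' => /act_inj; rewrite subn1 => /esym/off'.
  case: ifP => le; last by congr f'; lia.
  by rewrite (_ : (n + `|q|).-1 = n) ?rn; [congr f'|]; lia.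
- by rewrite !leq0n r0 GRing.addr0.
- rewrite ifF; last by lia.
  rewrite (_ : n - _ = 0); last by lia.
  by rewrite r0 yf; congr f; lia.
- move=> /(_ 1); rewrite n0 ifT; last by lia.
  by move=> e; apply: off (e _); lia.
Qed.

Lemma common_axis y f f' p q : line f -> line f' ->
    translates y f p -> translates y f' q -> p != 0%R -> q != 0%R ->
  (exists s, forall i, f' i = f (i + s)%R) \/
  (exists s, forall i, f' i = f (s - i)%R).
Proof.
move=> fL f'L yf yf' p0 q0.
wlog {p0} p0 : y p q yf yf' q0 / (0 < p)%R.
  move=> W; have [pp|pn] : (0 < p)%R \/ (0 < - p)%R by lia.
    exact: W yf yf' q0 pp.
  by apply: W (translatesV yf) (translatesV yf') _ pn; lia.
have [qp|qn] : (0 < q)%R \/ (0 < - q)%R by lia.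
  by left; apply: common_axis_pos yf yf' p0 qp.
have yr : translates y (fun i => f' (- i)%R) (- q)%R.
  by move=> i; rewrite yf'; congr f'; lia.
have [s sE] := common_axis_pos fL (line_rev f'L) yf yr p0 qn.
by right; exists s => i; rewrite -{1}(GRing.opprK i) sE; congr f; lia.
Qed.

(** [kind] is true on the vertices of type Z. It alternates along edges and is preserved by the
    action, so no element inverts an edge. *)
Variable kind : V -> bool.
Hypothesis kind_adj : forall u v, adj u v -> kind v = ~~ kind u.
Hypothesis kind_act : forall x v, kind (act x v) = kind v.

(** The axis is the union of the translates, under powers of [x], of a shortest path from a vertex
    to its image. Backtracking at a junction would give such a path shorter by 2; length 1 is
    excluded by [kind]. *)
Lemma axis_ex x (v0 : V) : (forall v, act x v <> v) ->
  exists f n, [/\ line f, translates x f n & (0 < n)%R].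
Proof.
move=> nofix.
pose moved n := `[< exists2 r, reduced_path n r & r n = act x (r 0) >].
have /ex_minnP[n /asboolP[r rP rn] nmin] : exists n, moved n.
  have [n [r rP [r0 rn]]] := tree_connected v0 (act x v0).
  by exists n; apply/asboolP; exists r; rewrite // rn r0.
have n2 : 1 < n.
  case: n rP rn {nmin} => [|[|n]] // [ra _] rn; first by case: (nofix (r 0)).
  by have := kind_adj (ra 0 isT); rewrite rn kind_act; case: (kind _).
have corner : r n.-1 <> act x (r 1).
  move=> e; have : n <= n - 2; last by lia.
  apply: nmin; apply/asboolP; exists (fun k => r (1 + k)).
    by apply: reduced_path_shift rP _; lia.
  by rewrite addn0 -e; congr r; lia.
(* Quotient and remainder of [i] by [n] give the translate and the position in it. In [fE] the case
   [k = n] is included: there two consecutive translates meet. *)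
pose f i := act (zpow x (i %/ n%:Z)%Z) (r `|(i %% n%:Z)%Z|).
have fE (a : int) (k : nat) : k <= n -> f (a * n%:Z + k%:Z)%R = act (zpow x a) (r k).
  rewrite leq_eqVlt => /orP[/eqP->|kn].
    rewrite /f divzMDl ?modzMDl ?modzz ?divzz; last by lia.
    by rewrite (_ : (Posz n != 0%R) = true) ?zpowS ?actM ?rn //; lia.
  rewrite /f divzMDl ?modzMDl; last by lia.
  by rewrite divz_small ?modz_small ?GRing.addr0 //; lia.
have split_n i : exists (a : int) (k : nat), i = (a * n%:Z + k%:Z)%R /\ k < n.
  by exists (i %/ n%:Z)%Z, `|(i %% n%:Z)%Z|; lia.
case: (rP) => ra rr.
exists f, (Posz n); split; last by lia.
- split=> i; have [a [k [-> kn]]] := split_n i.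
    rewrite -GRing.addrA (_ : (k%:Z + 1)%R = k.+1); last by lia.
    by rewrite !fE ?(ltnW kn) //; apply: act_adj; apply: ra.
  have [k2|k2] : k.+1 < n \/ k = n.-1 by lia.
    rewrite -GRing.addrA (_ : (k%:Z + 2)%R = k.+2); last by lia.
    by rewrite !fE ?(ltnW kn) //; move/act_inj; apply: rr.
  rewrite (_ : (a * n%:Z + k%:Z + 2)%R = ((a + 1) * n%:Z + 1%:Z)%R); last by lia.
  by rewrite !fE ?(ltnW kn) // ?(ltnW n2) // zpowS actM k2 => /act_inj.
- move=> i; have [a [k [-> kn]]] := split_n i.
  rewrite (_ : (a * n%:Z + k%:Z + n%:Z)%R = ((a + 1) * n%:Z + k%:Z)%R); last by lia.
  by rewrite !fE ?(ltnW kn) // GRing.addrC zpowD actM.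
Qed.

Hypothesis fix_kind : forall x v, x <> 1%g -> act x v = v ->
  exists2 z, kind z & act x z = z.
Hypothesis fix_star : forall x v z z', x <> 1%g -> ~~ kind v -> act x v = v ->
  adj v z -> adj v z' -> act x z = z -> act x z' = z' -> z = z'.
Hypothesis stab_cyclic : forall z, kind z ->
  exists a, forall x, act x z = z <-> powers a x.
Hypothesis stab_torsionless : forall z x n, kind z -> act x z = z ->
  (x ^+ n.+1)%g = 1%g -> x = 1%g.

(** The path between two fixed vertices is fixed pointwise. If it is not constant, its second vertex
    is of the other type and has two fixed neighbours, against [fix_star]. *)
Lemma fixed_kind_uniq x z z' : x <> 1%g -> kind z -> kind z' ->
  act x z = z -> act x z' = z' -> z = z'.
Proof.
move=> x1 kz kz' xz xz'.
have [n [p pP [p0 pn]]] := tree_connected z z'.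
have pfix i : i <= n -> act x (p i) = p i.
  have [||_] := reduced_path_uniq (act_path x pP) pP; rewrite ?p0 ?pn //.
  exact.
case: n pP pn pfix => [|[|n]] [pa pr] pn pfix.
- by rewrite -p0 pn.
- by have := kind_adj (pa 0 isT); rewrite p0 pn kz kz'.
- case: (pr 0) => //; apply: (@fix_star x (p 1)) => //.
  + by rewrite (kind_adj (pa 0 isT)) p0 kz.
  + exact: pfix.
  + by apply/adj_sym/pa.
  + exact: pa.
  + exact: pfix.
  + exact: pfix.
Qed.

(** A line contains two distinct vertices of type Z, at distance 2. *)
Lemma line_fix f x : line f -> translates x f 0%R -> x = 1%g.
Proof.
move=> [fa fr] xf; have [//|x1] := EM (x = 1%g).
have xfix i : act x (f i) = f i by rewrite xf GRing.addr0.
have [i ki] : exists i, kind (f i).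
  case: (boolP (kind (f 0%R))) => k0; first by exists 0%R.
  by exists (0 + 1)%R; rewrite (kind_adj (fa 0%R)).
case: (fr i); apply: (@fixed_kind_uniq x) => //.
rewrite (_ : (i + 2)%R = (i + 1 + 1)%R); last by lia.
by rewrite (kind_adj (fa _)) (kind_adj (fa _)) ki.
Qed.

(** The generator has the least positive translation length; division with remainder reduces any
    other translation to length 0, which [line_fix] makes trivial. *)
Lemma line_stab_cyclic f x n : line f -> translates x f n -> (0 < n)%R ->
  exists a, forall y, (exists s, translates y f s) <-> powers a y.
Proof.
move=> fL xf n0.
pose shift k := `[< (0 < k) /\ exists y, translates y f (Posz k) >].
have /ex_minnP[s /asboolP[s0 [a aE] smin]] : exists k, shift k.
  exists `|n|; apply/asboolP; split; first by lia.
  by exists x; rewrite gez0_abs //; lia.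
exists a => y; split=> [[t yt]|[t ->]]; last first.
  by exists (s%:Z * t)%R; apply: translates_zpow.
have r0 : (t %% s%:Z)%Z = 0%R.
  have [//|rn] := EM ((t %% s%:Z)%Z = 0%R).
  have : s <= `|(t %% s%:Z)%Z|; last by lia.
  apply: smin; apply/asboolP; split; first by lia.
  exists (y * zpow a (- (t %/ s%:Z)%Z)%R)%g.
  rewrite (_ : Posz `|(t %% Posz s)%Z| = (t + s%:Z * - (t %/ s%:Z)%Z)%R);
    last by have := divz_eq t s; lia.
  exact/translatesM/translates_zpow.
exists (t %/ s%:Z)%Z; apply/divg1_eq/(line_fix fL).
rewrite -zpowN (_ : 0%R = (t + s%:Z * - (t %/ s%:Z)%Z)%R); last by have := divz_eq t s; lia.
exact/translatesM/translates_zpow.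
Qed.

Lemma tree_action_torsionless : V -> torsionless Gam.
Proof.
move=> v0 x n xn; have [//|x1] := EM (x = 1%g).
have [[v xv]|nofix] := EM (exists v, act x v = v).
  have [z kz xz] := fix_kind x1 xv.
  exact: stab_torsionless kz xz xn.
have [v e|f [m [fL xf m0]]] := @axis_ex x v0; first by apply: nofix; exists v.
have := translates_zpow n.+1 xf 0%R.
rewrite /zpow xn act1 => /(line_inj fL) e; exfalso; move: e m0; clear; nia.
Qed.

(** If [y ^ g] preserves a vertex or a line, then [y] preserves its image under [g]. Hence when [y]
    and [y ^ g] both stabilize the fixed vertex, resp. the axis, of [x], uniqueness forces [g] to
    preserve it as well. *)
Lemma tree_action_cyclic_CSA : V -> cyclic_CSA Gam.
Proof.
move=> v0; have tf := tree_action_torsionless v0; split=> // x x1.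
have swap y g v : act y (act g v) = act g (act (y ^ g)%g v).
  by rewrite -!actM -conjgC.
have [[v xv]|nofix] := EM (exists v, act x v = v).
  have [z kz xz] := fix_kind x1 xv; have [a aE] := stab_cyclic kz.
  exists a; first exact/aE.
  move=> g y y1 /aE yz /aE ygz; apply/aE.
  apply: (fixed_kind_uniq y1 _ kz _ yz); first by rewrite kind_act.
  by rewrite swap; congr (act g _); apply/ygz.
have [v e|f [m [fL xf m0]]] := @axis_ex x v0; first by apply: nofix; exists v.
have [a aE] := line_stab_cyclic fL xf m0.
exists a; first by apply/aE; exists m.
move=> g y y1 /aE[p yp] /aE[q yq]; apply/aE.
have yg : translates y (fun i => act g (f i)) q by move=> i; rewrite swap yq.
have p0 : p != 0%R.
  by apply/eqP => p0; apply: y1; apply: (line_fix fL); rewrite -p0.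
have q0 : q != 0%R.
  apply/eqP => q0; apply: y1; apply/eqP; rewrite -(conjg_eq1 y g); apply/eqP.
  by apply: (line_fix fL); rewrite -q0.
have [[s sE]|[s sE]] := common_axis fL (act_line g fL) yp yg p0 q0.
  by exists s.
(* [g] reflects the axis, so its square fixes the axis and [g] is a torsion element. *)
have -> : g = 1%g.
  apply: (tf _ 1); apply: (line_fix fL) => i.
  by rewrite expg2 actM !sE; congr f; lia.
by exists 0%R => i; rewrite act1 GRing.addr0.
Qed.

End Actions.
End Trees.

(** * The fundamental group of a graph of groups *)

Section Transversal.
Variables (C A : groupType) (f : C -> A).
Hypothesis fM : {morph f : x y / x * y}.
Hypothesis f_inj : injective f.

(** The representative of the subgroup itself is normalised to 1, so that the edge back to a parent
    can be recognised by representative 1. *)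
Definition coset_rep (g : A) : A :=
  if `[< exists c, g = f c >] then 1 else xget g [set h | exists c, h = g * f c].

Definition coset_coord (g : A) : C := xget 1 [set c | g = coset_rep g * f c].

Lemma coset_rep_coord g : g = coset_rep g * f (coset_coord g).
Proof.
rewrite /coset_coord; case: xgetP => [c _ //|noc]; exfalso.
rewrite /coset_rep in noc; case: asboolP noc => [[c gc] /(_ c)|_].
  by apply; rewrite /= mul1g.
case: xgetP => [h -> [c ->]|nox _].
  by move=> /(_ c^-1); apply; rewrite /= -mulgA -fM mulgV (morph1 fM) mulg1.
by apply: (nox g); exists 1; rewrite (morph1 fM) mulg1.
Qed.

Lemma coset_repM g c : coset_rep (g * f c) = coset_rep g.
Proof.
(* The default values [g] and [g * f c] differ; the two choices agree because the coset chosen from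
   is nonempty. *)
have key (P : Prop) Q (x y : A) (S T : set A) : P = Q -> S = T ->
    (~ P -> exists z, S z) ->
    (if `[< P >] then 1 else xget x S) = (if `[< Q >] then 1 else xget y T).
  move=> <- <- ne; case: asboolP => // /ne[z Sz].
  by rewrite /xget; case: pselect => // -[]; exists z; apply/asboolP.
apply: key.
- apply/propext; split=> -[d e]; last by exists (d * c); rewrite fM -e.
  by exists (d * c^-1); rewrite fM -e (morphV fM) mulgK.
- apply/seteqP; split=> h [d ->].
    by exists (c * d); rewrite fM mulgA.
  by exists (c^-1 * d); rewrite fM (morphV fM) mulgA mulgK.
- by move=> _; exists (g * f c), 1 => /=; rewrite (morph1 fM) mulg1.
Qed.

Lemma coset_repf c : coset_rep (f c) = 1.
Proof. by rewrite /coset_rep ifT //; apply/asboolP; exists c. Qed.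

Lemma coset_rep1 : coset_rep 1 = 1.
Proof. by rewrite -{1}(morph1 fM) coset_repf. Qed.

Lemma coset_rep_id g : coset_rep (coset_rep g) = coset_rep g.
Proof. by rewrite [in RHS](coset_rep_coord g) coset_repM. Qed.

Lemma coset_coordM r c : coset_rep r = r -> coset_coord (r * f c) = c.
Proof.
move=> rr; apply/f_inj/(mulgI r).
by rewrite [in RHS](coset_rep_coord (r * f c)) coset_repM rr.
Qed.

Lemma coset_coord_rep r : coset_rep r = r -> coset_coord r = 1.
Proof. by move=> rr; rewrite -{1}(mulg1 r) -(morph1 fM) coset_coordM. Qed.

Lemma coset_coordMr g c : coset_coord (g * f c) = coset_coord g * c.
Proof.
by rewrite {1}(coset_rep_coord g) -mulgA -fM coset_coordM ?coset_rep_id.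
Qed.

End Transversal.

(* A graph of groups with two vertices, [vgroup] and [hub], joined by a family of
   edges indexed by [hub_index]; all edges carry the same group [egroup], embedded
   in [hub] by a map that does not depend on the edge. *)
Record star_of_groups := StarOfGroups {
  hub_index : choiceType;
  vgroup : groupType;
  hub : groupType;
  egroup : groupType;
  vincl : hub_index -> egroup -> vgroup;
  hincl : egroup -> hub;
  vinclM : forall i, {morph vincl i : x y / x * y};
  hinclM : {morph hincl : x y / x * y};
  vincl_inj : forall i, injective (vincl i);
  hincl_inj : injective hincl
}.

Section FundamentalGroup.
Variable D : star_of_groups.
Let I := hub_index D.
Let A := vgroup D.
Let B := hub D.
Let C := egroup D.
Let al : I -> C -> A := @vincl D.
Let be : C -> B := @hincl D.
Let alM i : {morph al i : x y / x * y} := @vinclM D i.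
Let beM : {morph be : x y / x * y} := @hinclM D.
Let al_inj i : injective (al i) := @vincl_inj D i.
Let be_inj : injective be := @hincl_inj D.
Let qA i := coset_rep (al i).
Let cA i := coset_coord (al i).
Let qB := coset_rep be.
Let cB := coset_coord be.

(* Vertices of the Bass-Serre tree are coded by the reduced path leading to them
   from the root, last step first. The step (i, r, j, m) leaves a [vgroup] vertex
   along the edge of index [i] and coset representative [r], and leaves the hub so
   reached along the edge [j] and representative [m]. The edge back to the parent
   has representative 1 in both cases, so [out_edge] and [hub_edge] exclude it. A
   frame is a vertex with an element of its group. *)
Definition step : Type := I * A * I * B.

Definition out_edge (v : seq step) (i : I) (r : A) : bool :=
  (qA i r == r) &&
  (if v is (_, _, j, _) :: _ then ~~ ((j == i) && (r == 1)) else true).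

Definition hub_edge (i j : I) (m : B) : bool :=
  (qB m == m) && ~~ ((j == i) && (m == 1)).

Fixpoint reduced (v : seq step) : bool :=
  if v is (i, r, j, m) :: v' then
    [&& reduced v', out_edge v' i r & hub_edge i j m]
  else true.

Definition hreduced (z : seq step * (I * A)) : bool :=
  reduced z.1 && out_edge z.1 z.2.1 z.2.2.

Definition vvertex := {v | reduced v}.
Definition hvertex := {z | hreduced z}.
Definition vframe : Type := vvertex * A.
Definition hframe : Type := hvertex * B.

(** * Crossing edges *)

Definition cross_raw i (v : seq step) (g : A) : (seq step * (I * A)) * B :=
  let r := qA i g in let c := cA i g in
  match v with
  | (i', r', j, m) :: v' =>
    if (j == i) && (r == 1) then ((v', (i', r')), m * be c) else ((v, (i, r)), be c)
  | [::] => ((v, (i, r)), be c)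
  end.

Lemma cross_raw_reduced i v g : reduced v -> hreduced (cross_raw i v g).1.
Proof.
have qq : qA i (qA i g) == qA i g by rewrite /qA coset_rep_id //; exact: alM.
case: v => [|[[[i' r'] j] m] v] /=; first by rewrite /hreduced /out_edge /= qq.
move=> /and3P[vP oP hP]; case: ifP => [_|n] /=; first by rewrite /hreduced /= vP.
by rewrite /hreduced /= vP oP hP /= /out_edge qq n.
Qed.

Definition cross i (w : vframe) : hframe :=
  (exist (fun z => is_true (hreduced z)) _ (cross_raw_reduced i w.2 (valP w.1)),
   (cross_raw i (val w.1) w.2).2).

(** The mirror image of [cross_raw]. In both, the coset of the group element selects an edge of
    index [i]: if it leads to the parent the last half step is erased, otherwise a new one is
    appended. The coordinate in the edge group is carried to the other side. *)
Definition back_raw i (z : seq step * (I * A)) (n : B) : seq step * A :=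
  let m := qB n in let c := cB n in
  if (i == z.2.1) && (m == 1) then (z.1, z.2.2 * al i c)
  else ((z.2.1, z.2.2, i, m) :: z.1, al i c).

Lemma back_raw_reduced i z n : hreduced z -> reduced (back_raw i z n).1.
Proof.
have qq : qB (qB n) == qB n by rewrite /qB coset_rep_id //; exact: beM.
rewrite /hreduced /back_raw => /andP[vP oP]; case: ifP => //= ne.
by rewrite vP oP /hub_edge qq ne.
Qed.

Definition back i (w : hframe) : vframe :=
  (exist (fun v => is_true (reduced v)) _ (back_raw_reduced i w.2 (valP w.1)),
   (back_raw i (val w.1) w.2).2).

Definition vact (g : A) (w : vframe) : vframe := (w.1, w.2 * g).
Definition hact (n : B) (w : hframe) : hframe := (w.1, w.2 * n).

Lemma vframe_eq (w w' : vframe) :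
  val w.1 = val w'.1 -> w.2 = w'.2 -> w = w'.
Proof. by case: w w' => v g [v' g'] /= /val_inj-> ->. Qed.

Lemma hframe_eq (w w' : hframe) :
  val w.1 = val w'.1 -> w.2 = w'.2 -> w = w'.
Proof. by case: w w' => v g [v' g'] /= /val_inj-> ->. Qed.

(** The way back recreates an erased step or erases a new one; reducedness of the code excludes the
    wrong branch. *)
Lemma crossK i : cancel (cross i) (back i).
Proof.
move=> [[v vP] g].
have gE := coset_rep_coord (@alM i) g.
have q1 : qB 1 = 1 by apply: coset_rep1; exact: beM.
have key z n w : cross_raw i v g = (z, n) -> back_raw i z n = w -> w = (v, g) ->
    let w0 : vframe := (exist _ v vP, g) in back i (cross i w0) = w0.
  move=> e1 e2 e3; apply: vframe_eq; rewrite /= e1 /= e2 e3 //.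
have kB c : qB (be c) = 1 /\ cB (be c) = c.
  split; first exact: coset_repf.
  by rewrite -[be c]mul1g; apply: coset_coordM => //.
case: v vP key => [|[[[i' r'] j] m] v] /= vP key.
  apply: (key _ _ _ erefl erefl).
  by rewrite /back_raw /= (kB _).1 (kB _).2 !eqxx /= -gE.
have [_ _ /andP[/eqP qm nm]] := and3P vP.
case: ifP key => [/andP[/eqP ji /eqP r1]|n] key; last first.
  apply: (key _ _ _ erefl erefl).
  by rewrite /back_raw /= (kB _).1 (kB _).2 !eqxx /= -gE.
apply: (key _ _ _ erefl erefl); rewrite /back_raw /=.
have -> : qB (m * be (cA i g)) = m by rewrite /qB coset_repM.
have -> : cB (m * be (cA i g)) = cA i g by rewrite /cB coset_coordM.
rewrite -ji (negbTE nm) ji; congr (_, _).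
by rewrite [RHS]gE -/(qA i g) r1 mul1g.
Qed.

Lemma backK i : cancel (back i) (cross i).
Proof.
move=> [[[v [i' r']] zP] n].
have nE := coset_rep_coord beM n.
have key w z : back_raw i (v, (i', r')) n = w -> cross_raw i w.1 w.2 = z ->
    z = ((v, (i', r')), n) ->
    let w0 : hframe := (exist _ (v, (i', r')) zP, n) in cross i (back i w0) = w0.
  by move=> e1 e2 e3; apply: hframe_eq; rewrite /= e1 e2 e3.
apply: (key _ _ erefl erefl).
have [/= vP /andP[/eqP qr np]] := andP zP.
rewrite /back_raw /=; case: ifP => [/andP[/eqP ei /eqP m1]|ne] /=.
  have q1 : qA i (r' * al i (cB n)) = r' by rewrite /qA coset_repM ?ei //; exact: alM.
  have c1 : cA i (r' * al i (cB n)) = cB n.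
    by rewrite /cA coset_coordM // ei.
  have nE1 : be (cB n) = n by rewrite [RHS]nE -/(qB n) m1 mul1g.
  rewrite /cross_raw q1 c1 nE1 ei.
  case: v vP np {zP key} => [|[[[? ?] j] ?] v] //= _ np.
  by rewrite (negbTE np).
have kA c : qA i (al i c) = 1 /\ cA i (al i c) = c.
  split; first exact: coset_repf.
  by rewrite -[al i c]mul1g; apply: coset_coordM => //; exact/coset_rep1/alM.
by rewrite (kA _).1 (kA _).2 !eqxx /= -nE.
Qed.

(** This is the gluing relation of the fundamental group: [al i c] on one side of the edge is [be c]
    on the other. *)
Lemma cross_vact i c w : cross i (vact (al i c) w) = hact (be c) (cross i w).
Proof.
case: w => [[v vP] g]; apply: hframe_eq => /=; rewrite /cross_raw;
  rewrite /qA /cA coset_repM ?coset_coordMr //; try exact: alM; try exact: al_inj;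
  case: v {vP} => [|[[[i' r'] j] m] v] //=; rewrite ?beM //;
  by case: ifP; rewrite // -?mulgA ?beM.
Qed.

(** * The group law on frames *)

Fixpoint follow (v : seq step) (w : vframe) : vframe :=
  if v is (i, r, j, m) :: v' then back j (hact m (cross i (vact r (follow v' w))))
  else w.

(* [vpush w x] is the frame [x * w]: the structure maps that lead from the base
   frame to [w] are applied to [x]. *)
Definition vpush (w x : vframe) : vframe := vact w.2 (follow (val w.1) x).

Definition hpush (z : hframe) (x : vframe) : hframe :=
  hact z.2 (cross (val z.1).2.1 (vact (val z.1).2.2 (follow (val z.1).1 x))).

Lemma vactM g g' w : vact (g * g') w = vact g' (vact g w).
Proof. by rewrite /vact mulgA. Qed.

Lemma hactM n n' z : hact (n * n') z = hact n' (hact n z).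
Proof. by rewrite /hact mulgA. Qed.

Lemma vpush_vact g w x : vpush (vact g w) x = vact g (vpush w x).
Proof. by rewrite /vpush vactM. Qed.

Lemma hpush_hact n z x : hpush (hact n z) x = hact n (hpush z x).
Proof. by rewrite /hpush hactM. Qed.

(** If the crossing erases the last step of the code, [follow] has ended with [back i], which
    [backK] cancels. *)
Lemma hpush_cross i w x : hpush (cross i w) x = cross i (vpush w x).
Proof.
case: w => [[v vP] g]; rewrite /hpush /vpush /=.
have gE := coset_rep_coord (@alM i) g.
have nonparent : hact (be (cA i g)) (cross i (vact (qA i g) (follow v x)))
    = cross i (vact g (follow v x)).
  by rewrite -cross_vact -vactM -gE.
case: v vP nonparent => [|[[[i' r'] j] m] v] //= _ nonparent.
case: ifP => [/andP[/eqP-> /eqP q1]|_] //=.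
by rewrite hactM -[in LHS](backK i (hact m _)) -cross_vact [in RHS]gE -/(qA i g) q1 mul1g.
Qed.

Lemma vpush_back i z x : vpush (back i z) x = back i (hpush z x).
Proof. by rewrite -{2}(backK i z) hpush_cross crossK. Qed.

Lemma vpush_follow v w x : vpush (follow v w) x = follow v (vpush w x).
Proof.
elim: v => [|[[[i r] j] m] v IH] //=.
by rewrite vpush_back hpush_hact hpush_cross vpush_vact IH.
Qed.

(** The fundamental group acts simply transitively on the frames of this type, so a frame stands for
    the element that carries [base] to it. *)
Definition pi1 : Type := vframe.

Definition base : pi1 := (exist (fun v => is_true (reduced v)) [::] isT, 1).
Definition pi1_mul (x y : pi1) : pi1 := vpush y x.

Lemma pi1_mulA : associative pi1_mul.
Proof. by move=> x y z; rewrite /pi1_mul [vpush z y]/vpush vpush_vact vpush_follow. Qed.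

(** Following a reduced code from [base] never backtracks, so it ends at the coded vertex with group
    element 1. *)
Lemma pi1_mul1l : left_id base pi1_mul.
Proof.
suff key v (vP : reduced v) :
    follow v base = (exist (fun v => is_true (reduced v)) v vP, 1).
  by move=> [[v vP] g]; rewrite /pi1_mul /vpush /= key /vact /= mul1g.
elim: v vP => [|[[[i r] j] m] v IH] vP; first by apply: vframe_eq.
have [v'P /andP[/eqP qr np] /andP[/eqP qm nm]] := and3P vP.
rewrite /= (IH v'P).
have -> : vact r (exist (fun v => is_true (reduced v)) v v'P, 1)
    = (exist (fun v => is_true (reduced v)) v v'P, r) by rewrite /vact mul1g.
have e : cross_raw i v r = ((v, (i, r)), 1).
  have c1 : cA i r = 1 by apply: coset_coord_rep => //; exact: al_inj.
  rewrite /cross_raw qr c1 (morph1 beM).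
  by case: v np {vP v'P IH} => [|[[[? ?] ?] ?] ?] //= /negbTE->.
have c1 : cB m = 1 by apply: coset_coord_rep => //; exact: be_inj.
apply: vframe_eq; rewrite /= !e /= mul1g /back_raw qm /= (negbTE nm) //.
by rewrite c1 (morph1 (@alM j)).
Qed.

Lemma pi1_mul1r : right_id base pi1_mul.
Proof. by move=> x; rewrite /pi1_mul /vpush /= /vact mulg1; case: x. Qed.

Lemma vpush_surj w u : exists x, vpush w x == u.
Proof.
suff key v y : exists x, follow v x = y.
  have [x e] := key (val w.1) (vact w.2^-1 u); exists x.
  by rewrite /vpush e -vactM mulVg /vact mulg1; case: u {e}.
elim: v y => [|[[[i r] j] m] v IH] y; first by exists y.
have [x e] := IH (vact r^-1 (back i (hact m^-1 (cross j y)))).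
exists x; rewrite /= e -vactM mulVg.
have -> w' : vact 1 w' = w' by rewrite /vact mulg1; case: w'.
rewrite backK -hactM mulVg.
have -> z : hact 1 z = z by rewrite /hact mulg1; case: z.
by rewrite crossK.
Qed.

Definition pi1_inv (w : pi1) : pi1 := xchoose (vpush_surj w base).

Lemma pi1_mulV : left_inverse base pi1_inv pi1_mul.
Proof. by move=> w; apply/eqP; exact: (xchooseP (vpush_surj w base)). Qed.

Lemma pi1_Vmul : right_inverse base pi1_inv pi1_mul.
Proof.
move=> x; set y := pi1_inv x.
rewrite -(pi1_mul1l (pi1_mul x y)) -{1}(pi1_mulV y) -pi1_mulA (pi1_mulA y).
by rewrite pi1_mulV pi1_mul1l pi1_mulV.
Qed.

End FundamentalGroup.

HB.instance Definition _ (D : star_of_groups) := Choice.on (pi1 D).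
HB.instance Definition _ (D : star_of_groups) := isGroup.Build (pi1 D)
  (@pi1_mulA D) (@pi1_mul1l D) (@pi1_mul1r D) (@pi1_mulV D) (@pi1_Vmul D).

(** * The Bass-Serre tree *)

Section BassSerreTree.
Variable D : star_of_groups.
Local Notation A := (vgroup D).
Local Notation B := (hub D).
Local Notation C := (egroup D).
Local Notation I := (hub_index D).
Local Notation al := (@vincl D).
Local Notation be := (@hincl D).
Implicit Types (x y : pi1 D) (w : vframe D) (z : hframe D).

(** The identity map, which lets a frame be multiplied as a group element. *)
Definition as_frame (w : vframe D) : pi1 D := w.

Lemma pi1M x y : (x * y)%g = vpush y x. Proof. by []. Qed.

Lemma pi1_mulvact x g w : x * as_frame (vact g w) = vact g (x * as_frame w).
Proof. exact: vpush_vact. Qed.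

Lemma hpushM z x y : hpush z (x * y) = hpush (hpush z y) x.
Proof.
by rewrite {1 3}/hpush hpush_hact hpush_cross vpush_vact -vpush_follow.
Qed.

Lemma hpush_cross_back i z x : hpush z x = cross i (x * as_frame (back i z)).
Proof. by rewrite -{1}(backK i z) hpush_cross. Qed.

Lemma hpush1 z : hpush z (1 : pi1 D) = z.
Proof. by rewrite (hpush_cross_back (val z.1).2.1) mul1g backK. Qed.

Lemma hpush_inj z : injective (hpush z).
Proof.
move=> x y; rewrite !(hpush_cross_back (val z.1).2.1).
by move/(can_inj (crossK _)); apply: (@mulIg (pi1 D)).
Qed.

Lemma hpush_ex z z' : exists x, hpush z x = z'.
Proof.
set i := (val z.1).2.1.
exists (as_frame (back i z') * (as_frame (back i z))^-1).
by rewrite (hpush_cross_back i) mulgVK backK.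
Qed.

Lemma hact1 z : hact 1 z = z.
Proof. by rewrite /hact mulg1; case: z. Qed.

(** [s n] is the element that carries [z] to [hact n z]. It is multiplicative because the left
    action commutes with [hact]. *)
Lemma hub_stabilizer z : exists s : B -> pi1 D,
  [/\ {morph s : m n / m * n}, injective s & forall n, hpush z (s n) = hact n z].
Proof.
have [s sE] := choice (fun n => hpush_ex z (hact n z)); exists s; split=> //.
  move=> m n; apply: (@hpush_inj z).
  by rewrite hpushM !sE hpush_hact sE hactM.
by move=> m n /(congr1 (hpush z)); rewrite !sE => -[/mulgI].
Qed.

Definition vact_vertex x (v : vvertex D) : vvertex D := (x * as_frame (v, 1)).1.
Definition hact_vertex x (z : hvertex D) : hvertex D := (hpush (z, 1) x).1.

Lemma vact_vertexE x w : (x * as_frame w).1 = vact_vertex x w.1.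
Proof.
case: w => v g; rewrite /vact_vertex.
by rewrite (_ : (v, g) = vact g (v, 1)) ?pi1_mulvact // /vact mul1g.
Qed.

Lemma hact_vertexE x z : (hpush z x).1 = hact_vertex x z.1.
Proof.
case: z => z n; rewrite /hact_vertex.
by rewrite (_ : (z, n) = hact n (z, 1)) ?hpush_hact // /hact mul1g.
Qed.

Definition vertex : Type := (vvertex D + hvertex D)%type.

Definition tree_act x (u : vertex) : vertex :=
  match u with inl v => inl (vact_vertex x v) | inr z => inr (hact_vertex x z) end.

Definition joined (v : vvertex D) (z : hvertex D) : Prop :=
  exists i g, (cross i (v, g)).1 = z.

Definition tree_adj (u u' : vertex) : Prop :=
  match u, u' with
  | inl v, inr z => joined v z
  | inr z, inl v => joined v z
  | _, _ => False
  end.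

Definition height (u : vertex) : nat :=
  match u with
  | inl v => (size (val v)).*2
  | inr z => (size (val z).1).*2.+1
  end.

Definition is_hub (u : vertex) : bool := if u is inr _ then true else false.

(** In the first case [z] is a child of [v], in the second its parent. *)
Lemma joinedP v (z : hvertex D) : joined v z ->
  (val z).1 = val v \/
  exists j m, val v = ((val z).2.1, (val z).2.2, j, m) :: (val z).1.
Proof.
case=> i [g <-] /=; rewrite /cross_raw.
case: v => [[|[[[i' r'] j] m] v] vP] /=; first by left.
by case: ifP => /= _; [right; exists j, m | left].
Qed.

(** The tree has no double edges. A child's code records the index and the coset, the edge to the
    parent is determined by [v], and a parent differs from a child in length. *)
Lemma joined_inj i j v g g' : (cross i (v, g)).1 = (cross j (v, g')).1 ->
  i = j /\ exists c, g' = g * al i c.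
Proof.
have same r : coset_rep (al i) g = r -> coset_rep (al i) g' = r ->
    exists c, g' = g * al i c.
  move=> e e'; have gE := coset_rep_coord (@vinclM D i) g.
  have g'E := coset_rep_coord (@vinclM D i) g'; rewrite {}e in gE; rewrite {}e' in g'E.
  exists ((coset_coord (al i) g)^-1 * coset_coord (al i) g').
  rewrite vinclM mulgA [X in X * _ * _]gE -(mulgA r) -vinclM mulgV.
  by rewrite (morph1 (@vinclM D i)) mulg1 -g'E.
have sz (x y : I * A * I * B) t : x :: t = t -> False.
  by move=> /(congr1 size) /=; lia.
move/(congr1 val) => /=; rewrite /cross_raw.
case: v => [[|[[[i' r'] k] m] v] vP] /=.
  by case=> ij; subst j => e; split=> //; apply: same e _.
case: ifP => [/andP[/eqP ki /eqP r1]|_]; case: ifP => [/andP[/eqP kj /eqP r1']|_] //=.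
- by move=> _; rewrite -ki -kj; split=> //; rewrite ki; apply: same r1 _; rewrite -ki kj.
- by case=> /(congr1 size) /=; lia.
- by case=> /(congr1 size) /=; lia.
- by case=> ij; subst j => e; split=> //; apply: same e _.
Qed.

Lemma tree_act1 u : tree_act 1 u = u.
Proof.
case: u => [v|z] /=; congr (_ _).
  by rewrite /vact_vertex mul1g.
by rewrite /hact_vertex hpush1.
Qed.

Lemma tree_actM x y u : tree_act (x * y) u = tree_act x (tree_act y u).
Proof.
case: u => [v|z] /=; congr (_ _).
  by rewrite /vact_vertex -mulgA [y * _ in LHS]surjective_pairing vact_vertexE.
by rewrite [in LHS]/hact_vertex hpushM hact_vertexE.
Qed.

Lemma tree_act_adj x u u' : tree_adj u u' -> tree_adj (tree_act x u) (tree_act x u').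
Proof.
have J v (z : hvertex D) : joined v z -> joined (vact_vertex x v) (hact_vertex x z).
  case=> i [g <-]; exists i, (x * as_frame (v, g)).2.
  rewrite -(hact_vertexE x (cross i (v, g))) hpush_cross.
  by rewrite -(vact_vertexE x (v, g)) -surjective_pairing.
by case: u u' => [v|z] [v'|z'] //=; apply: J.
Qed.

Lemma tree_adj_sym u u' : tree_adj u u' -> tree_adj u' u.
Proof. by case: u u' => [v|z] [v'|z']. Qed.

Lemma tree_adj_height u u' :
  tree_adj u u' -> height u = (height u').+1 \/ height u' = (height u).+1.
Proof.
have J v (z : hvertex D) : joined v z -> height (inl v) = (height (inr z)).+1 \/
    height (inr z) = (height (inl v)).+1.
  by case/joinedP => [e|[j [m e]]] /=; rewrite e; [right | left].
by case: u u' => [v|z] [v'|z'] //= /J[] /=; auto.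
Qed.

Lemma tree_parent_uniq u u1 u2 : tree_adj u u1 -> tree_adj u u2 ->
  (height u1 < height u)%N -> (height u2 < height u)%N -> u1 = u2.
Proof.
case: u u1 u2 => [v|z] [v1|z1] [v2|z2] //= /joinedP J1 /joinedP J2 l1 l2; congr (_ _).
  case: J1 => [e1|[j1 [m1 e1]]]; first by move: l1; rewrite e1 ltnNge leqnSn.
  case: J2 => [e2|[j2 [m2 e2]]]; first by move: l2; rewrite e2 ltnNge leqnSn.
  apply: val_inj; move: e1 e2; case: (val z1) (val z2) => [t1 [i1 r1]] [t2 [i2 r2]] /= ->.
  by case=> -> -> _ _ ->.
case: J1 => [e1|[j1 [m1 e1]]]; last by move: l1; rewrite e1 /= ltnNge; lia.
case: J2 => [e2|[j2 [m2 e2]]]; last by move: l2; rewrite e2 /= ltnNge; lia.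
by apply: val_inj; rewrite -e1.
Qed.

Lemma tree_parent_ex u : (0 < height u)%N ->
  exists2 u', tree_adj u u' & (height u' < height u)%N.
Proof.
case: u => [[[|[[[i r] j] m] v] vP]|[[v [i r]] zP]] //= _.
  have [v'P oP _] := and3P vP.
  have zP : hreduced (v, (i, r)) by apply/andP.
  exists (inr (exist (fun t => is_true (hreduced t)) _ zP)); last by rewrite /=; lia.
  exists j, 1; apply: val_inj; rewrite /= eqxx coset_rep1 ?eqxx //.
  exact: vinclM.
have [/= vP /andP[/eqP qr np]] := andP zP.
exists (inl (exist (fun t => is_true (reduced t)) _ vP)); last by rewrite /=.
exists i, r; apply: val_inj; rewrite /= /cross_raw qr.
by case: v np {vP zP} => [|[[[? ?] ?] ?] ?] //= /negbTE->.
Qed.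

Lemma tree_root_uniq u u' : height u = 0%N -> height u' = 0%N -> u = u'.
Proof.
case: u u' => [[[|s v] vP]|z] [[[|s' v'] v'P]|z'] //= _ _.
by congr inl; apply: val_inj.
Qed.

Lemma tree_act_hub x u : is_hub (tree_act x u) = is_hub u.
Proof. by case: u. Qed.

Lemma tree_adj_hub u u' : tree_adj u u' -> is_hub u' = ~~ is_hub u.
Proof. by case: u u' => [v|z] [v'|z']. Qed.

Definition pi1_incl (g : A) : pi1 D := vact g (base D).

Lemma pi1_inclM : {morph pi1_incl : g g' / g * g'}.
Proof. by move=> g g'; rewrite /pi1_incl vactM pi1_mulvact /as_frame mulg1. Qed.

Lemma pi1_incl_inj : injective pi1_incl.
Proof. by move=> g g' []; rewrite !mul1g. Qed.

(** [s i] describes the stabilizer of the hub vertex next to the base along edge [i]. The hub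
    vertices form one orbit, whence the conjugacy that the root extension exploits. *)
Lemma hub_subgroups : exists s : I -> B -> pi1 D,
  [/\ forall i, {morph s i : m n / m * n},
      forall i c, s i (be c) = pi1_incl (al i c) &
      forall i j, exists g, forall n, s i n = s j n ^ g].
Proof.
have [s sP] := choice (fun i => hub_stabilizer (cross i (base D))).
exists s; split=> [i|i c|i j]; first by case: (sP i).
  have [_ _ sE] := sP i; apply: (@hpush_inj (cross i (base D))).
  rewrite sE hpush_cross -cross_vact; congr cross.
  by rewrite -[vact _ (base D)]/(pi1_incl _) -[LHS]mulg1.
have [g gE] := hpush_ex (cross i (base D)) (cross j (base D)); exists g => n.
have [_ _ siE] := sP i; have [_ _ sjE] := sP j.
apply: (mulgI g); rewrite -conjgC; apply: (@hpush_inj (cross i (base D))).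
by rewrite !hpushM gE sjE siE hpush_hact gE.
Qed.

(** This and the next condition say that a nontrivial element of a stabilizer of type [A] fixes
    exactly one edge there: the first gives existence, the second uniqueness. *)
Hypothesis vincl_cover : forall g : A, g <> 1 ->
  exists i r c, g = r * al i c * r^-1.
Hypothesis vincl_malnormal : forall i j g c d, c <> 1 ->
  al i c ^ g = al j d -> i = j /\ exists e, g = al i e.
Hypothesis hub_cyclic : exists b : B, forall n, powers b n.
Hypothesis hub_torsionless : torsionless B.

Lemma pi1_cyclic_CSA : cyclic_CSA (pi1 D).
Proof.
have inr_inj x (a b : hvertex D) :
  tree_act x (inr a) = inr b -> hact_vertex x a = b by case.
(* [x] acts on the frames over a fixed vertex [v] by left multiplication with one element [g]. *)
have fixed_nontrivial x v : x <> 1 -> vact_vertex x v = v ->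
    exists2 g, g <> 1 & forall r, x * as_frame (v, r) = (v, g * r).
  move=> x1 xv; exists (x * as_frame (v, 1)).2 => [g1|r].
    apply: x1; apply: (mulIg (as_frame (v, 1))); rewrite mul1g.
    by rewrite [LHS]surjective_pairing g1 vact_vertexE xv.
  have -> : (v, r) = vact r (v, 1) by rewrite /vact mul1g.
  by rewrite pi1_mulvact /vact vact_vertexE xv.
apply: (@tree_action_cyclic_CSA _ tree_adj height tree_adj_sym tree_adj_height
  tree_parent_uniq tree_parent_ex tree_root_uniq _ tree_act tree_act1 tree_actM
  tree_act_adj is_hub tree_adj_hub tree_act_hub).
- move=> x [v|z] x1 /=; last by exists (inr z).
  case=> /(fixed_nontrivial x v x1)[g /vincl_cover[i [r [c ->]]] gE].
  exists (inr (cross i (v, r)).1) => //; congr inr.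
  rewrite -hact_vertexE hpush_cross -[vpush _ _]/(x * as_frame (v, r)) gE mulgVK.
  by rewrite -[(v, r * _)]/(vact (al i c) (v, r)) cross_vact.
- move=> x [v|//] [//|z] [//|z'] x1 _ [/(fixed_nontrivial x v x1)[g g1 gE]].
  (* Fixing both edges means [g * r = r * al i c] and [g * r' = r' * al j d], so [r^-1 * r']
     conjugates [al i c] to [al j d]. *)
  case=> i [r <-] [j [r' <-]] /inr_inj xz /inr_inj xz'; congr inr.
  move: xz; rewrite -hact_vertexE hpush_cross -[vpush _ _]/(x * as_frame (v, r)) gE.
  move=> /esym/joined_inj[_ [c gr]].
  move: xz'; rewrite -hact_vertexE hpush_cross -[vpush _ _]/(x * as_frame (v, r')) gE.
  move=> /esym/joined_inj[_ [d gr']].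
  have c1 : c <> 1.
    move=> c1; apply: g1; apply: (mulIg r).
    by rewrite gr c1 (morph1 (@vinclM D i)) mulg1 mul1g.
  have [|ij [e rE]] := @vincl_malnormal i j (r^-1 * r') c d c1.
    rewrite conjgE invgM invgK -!mulgA (mulgA r) -gr.
    by rewrite -(mulgA g) mulVKg gr' mulKg.
  subst j; have -> : r' = r * al i e by rewrite -rE mulVKg.
  by rewrite -[(v, r * _)]/(vact (al i e) (v, r)) cross_vact.
- move=> [//|z] _; have [s [sM s_inj sE]] := hub_stabilizer (z, 1).
  have [b bE] := hub_cyclic.
  exists (s b) => x; split=> [[xz]|[n ->]].
    have [n nE] := bE (hpush (z, 1) x).2; exists n.
    rewrite -morph_zpow // -nE; apply: (@hpush_inj (z, 1)).
    by rewrite sE /hact mul1g [LHS]surjective_pairing hact_vertexE xz.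
  by rewrite -morph_zpow //= /hact_vertex sE.
- move=> [//|z] x n _ [xz] xn; have [s [sM s_inj sE]] := hub_stabilizer (z, 1).
  have xE : x = s (hpush (z, 1) x).2.
    apply: (@hpush_inj (z, 1)).
    by rewrite sE /hact mul1g [LHS]surjective_pairing hact_vertexE xz.
  move: xn; rewrite xE -[_ ^+ _]/(zpow _ n.+1) -morph_zpow // -(morph1 sM).
  by move=> /s_inj/hub_torsionless->.
- exact: inl (base D).1.
Qed.

End BassSerreTree.

(** * Adjoining roots and conjugators *)

(** The infinite cyclic group: the additive group of [int] in multiplicative notation. *)
Definition mulint : Type := int.
HB.instance Definition _ := Choice.on mulint.
HB.instance Definition _ := isGroup.Build mulint
  (@GRing.addrA int) (@GRing.add0r int) (@GRing.addr0 int)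
  (@GRing.addNr int) (@GRing.addrN int).

Lemma mulintM (m n : int) : (m : mulint) * n = (m + n)%R. Proof. by []. Qed.

Lemma zpow_mulint (m n : int) : zpow (m : mulint) n = (m * n)%R.
Proof.
elim/int_rect: n => [|n IH|n IH]; first by rewrite GRing.mulr0.
  rewrite (_ : Posz n.+1 = (n%:Z + 1)%R) ?zpowS ?mulintM ?IH; last by lia.
  by rewrite GRing.mulrDr GRing.mulr1.
apply: (@mulIg mulint m); rewrite -zpowS.
rewrite (_ : (- n.+1%:Z + 1)%R = (- n%:Z)%R); last by lia.
by rewrite IH mulintM; lia.
Qed.

Lemma mulint_torsionless : torsionless mulint.
Proof.
move=> m n; rewrite -[_ ^+ _]/(zpow m n.+1) => e.
have : ((m : int) * n.+1)%R = 0%R by rewrite -zpow_mulint e.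
by move=> /eqP; rewrite GRing.mulf_eq0 orbF => /eqP.
Qed.

Lemma mulint_cyclic (n : mulint) : powers (1%R : mulint) n.
Proof. by exists n; rewrite zpow_mulint GRing.mul1r. Qed.

(** * Representatives of the conjugacy classes of malnormal cyclic subgroups *)

Section Powers.
Variable G : groupType.
Implicit Types a b x y g : G.

Lemma powers_trans a b x : powers a b -> powers b x -> powers a x.
Proof. by case=> m -> [n ->]; exists (m * n)%R; rewrite zpowM. Qed.

Lemma powersJ a x g : powers a x -> powers (a ^ g) (x ^ g).
Proof. by case=> n ->; exists n; rewrite zpowJ. Qed.

Lemma powers_fix a x y : powers_malnormal a -> powers a x -> x <> 1 ->
  x * y = y * x -> powers a y.
Proof.
move=> am ax x1 xy; apply: (am y x) => //.
by rewrite conjgE xy mulKg.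
Qed.

Lemma powers_malnormal_gen a b :
  powers_malnormal a -> a <> 1 -> powers b a -> powers a b.
Proof.
move=> am a1 [n aE]; apply: (powers_fix am) a1 _; first by exists 1%R.
by rewrite [in LHS]aE [in RHS]aE -{2}(zpow1 b) zpow_comm.
Qed.

(** In a torsion-free group, for nontrivial generators of malnormal cyclic subgroups, this amounts
    to conjugacy of the subgroups. *)
Definition commensurable x y : Prop :=
  exists g m n, [/\ m != 0%R, n != 0%R & zpow x m ^ g = zpow y n].

Lemma commensurable_sym x y : commensurable x y -> commensurable y x.
Proof.
by case=> g [m [n [m0 n0 e]]]; exists g^-1, n, m; rewrite -e conjgK.
Qed.

Lemma commensurable_trans y x z :
  commensurable x y -> commensurable y z -> commensurable x z.
Proof.
case=> g [m [n [m0 n0 e]]] [h [p [q [p0 q0 e']]]].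
exists (g * h), (m * p)%R, (q * n)%R; split; try by rewrite GRing.mulf_neq0.
by rewrite conjgM !zpowM [zpow _ p ^ g]zpowJ e -zpowM GRing.mulrC zpowM zpowJ e'.
Qed.

(** Commensurable elements give the same set to choose from, hence the same representative. *)
Definition class_rep x : G :=
  xget 1 [set b | [/\ b <> 1, powers_malnormal b & commensurable x b]].

Hypothesis Gcsa : cyclic_CSA G.

Lemma class_repP x : x <> 1 ->
  [/\ class_rep x <> 1, powers_malnormal (class_rep x) & commensurable x (class_rep x)].
Proof.
move=> x1; apply: (@xgetPex _ 1
  [set b | [/\ b <> 1, powers_malnormal b & commensurable x b]]).
have [a [n xE] am] := Gcsa.2 x x1; exists a; split=> //.
  by move=> a1; apply: x1; rewrite xE a1 zpow1n.
exists 1, 1%R, n; split=> //; last by rewrite conjg1 zpow1.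
by apply/eqP => n0; apply: x1; rewrite xE n0.
Qed.

Lemma class_rep_eq x y : commensurable x y -> class_rep x = class_rep y.
Proof.
move=> xy; congr xget; apply/seteqP; split=> b [b1 bm xb]; split=> //.
  exact: commensurable_trans (commensurable_sym xy) xb.
exact: commensurable_trans xy xb.
Qed.

Definition is_class_rep b : bool := `[< b <> 1 /\ class_rep b = b >].
Definition class_reps := {b | is_class_rep b}.

Lemma class_reps_malnormal (i : class_reps) : val i <> 1 /\ powers_malnormal (val i).
Proof.
have /asboolP[b1 bE] := valP i; split=> //.
by rewrite -bE; case: (class_repP b1).
Qed.

(** A conjugate of [x] has a nontrivial power in the malnormal subgroup of [b] and commutes with it,
    so it lies there itself. *)
Lemma class_reps_cover x : x <> 1 ->
  exists (i : class_reps) r c, x = r * zpow (val i) c * r^-1.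
Proof.
move=> x1; have [b1 bm xb] := class_repP x1; set b := class_rep x in b1 bm xb.
have bP : is_class_rep b by apply/asboolP; split; rewrite -?(class_rep_eq xb).
have [g [m [n [m0 n0 e]]]] := xb.
have [c cE] : powers b (x ^ g).
  apply: (powers_fix bm (x := zpow b n)); first by exists n.
    by move/(torsionless_zpow Gcsa.1 n0).
  by rewrite -e zpowJ -[X in _ * X]zpow1 zpow_comm zpow1.
by exists (exist _ b bP), g, c; rewrite /= -cE conjgE !mulgA mulgV mul1g mulgK.
Qed.

Lemma class_reps_conj (i j : class_reps) g c d : c != 0%R ->
  zpow (val i) c ^ g = zpow (val j) d -> i = j /\ powers (val i) g.
Proof.
have [i1 im] := class_reps_malnormal i; have [/= j1 _] := class_reps_malnormal j.
move=> c0 e; have ic1 : zpow (val i) c <> 1 by move/(torsionless_zpow Gcsa.1 c0).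
have d0 : d != 0%R.
  apply/eqP => d0; apply: ic1; apply/eqP.
  by rewrite -(conjg_eq1 _ g) e d0.
have ij : i = j.
  apply: val_inj; have /asboolP[_ <-] := valP i; have /asboolP[_ <-] := valP j.
  by apply: class_rep_eq; exists g, c, d.
split=> //; apply: im ic1 _ _; first by exists c.
by rewrite e -ij; exists d.
Qed.

End Powers.

Section RootExtension.
Variables (G : groupType) (k : nat).
Hypotheses (Gcsa : cyclic_CSA G) (k0 : (0 < k)%N).

Lemma root_vinclM (i : class_reps G) :
  {morph (fun c : mulint => zpow (val i) c) : m n / m * n}.
Proof. by move=> m n; rewrite -zpowD. Qed.

Lemma root_hinclM :
  {morph (fun c : mulint => (c * k%:Z)%R : mulint) : m n / m * n}.
Proof. by move=> m n; rewrite mulintM GRing.mulrDl. Qed.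

Lemma root_vincl_inj (i : class_reps G) :
  injective (fun c : mulint => zpow (val i) c).
Proof.
by have [i1 _] := class_reps_malnormal Gcsa i; apply: torsionless_zpow_inj Gcsa.1 i1.
Qed.

Lemma root_hincl_inj : injective (fun c : mulint => (c * k%:Z)%R : mulint).
Proof. by move=> m n; apply: GRing.mulIf; lia. Qed.

Definition root_star : star_of_groups :=
  StarOfGroups root_vinclM root_hinclM root_vincl_inj root_hincl_inj.

Lemma root_extension : exists (H : groupType) (f : G -> H),
  [/\ {morph f : x y / x * y}, injective f, cyclic_CSA H,
      forall x, exists y, y ^+ k = f x &
      forall a b, a <> 1 -> b <> 1 -> powers_malnormal a -> powers_malnormal b ->
        exists g, powers (f b) = powers (f a ^ g)].
Proof.
pose f : G -> pi1 root_star := @pi1_incl root_star.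
have fM : {morph f : x y / x * y} := @pi1_inclM root_star.
exists (pi1 root_star), f.
have [s [sM sE s_conj]] := hub_subgroups root_star.
have fE i c : f (vincl (s := root_star) i c) = s i (hincl c) := esym (sE i c).
split=> //.
- exact: pi1_incl_inj.
- apply: pi1_cyclic_CSA.
  + by move=> g /(class_reps_cover Gcsa).
  + move=> i j g c d c1 e.
    have [|-> [n ->]] := class_reps_conj Gcsa _ e; last by split=> //; exists n.
    by apply/eqP.
  + by exists (1%R : mulint); apply: mulint_cyclic.
  + exact: mulint_torsionless.
- move=> x; have [->|x1] := EM (x = 1).
    by exists 1; rewrite expg1n (morph1 fM).
  have [i [r [c ->]]] := class_reps_cover Gcsa x1.
  (* The [k]-th power of [s i c] is [s i (c * k)], which the gluing identifies with the image of the
     [c]-th power of [val i]. *)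
  exists (s i c ^ (f r^-1)).
  rewrite -conjXg conjgE (morphV fM) invgK !fM (morphV fM) -!mulgA; congr (_ * (_ * _)).
  rewrite -[zpow _ _]/(vincl (s := root_star) i c) fE.
  rewrite -[_ ^+ _]/(zpow (s i c) k) -(morph_zpow (sM i)).
  by rewrite zpow_mulint.
(* [a] lies in a conjugate of a chosen cyclic subgroup, and a nontrivial malnormal cyclic subgroup
   is not properly contained in a cyclic one. *)
- have rep a : a <> 1 -> powers_malnormal a -> exists (i : class_reps G) g,
      powers (f a)
      = powers (f (val i) ^ g).
    move=> a1 am; have [i [r [c aE]]] := class_reps_cover Gcsa a1.
    have ab : powers (val i ^ r^-1) a.
      by exists c; rewrite -zpowJ conjgE invgK mulgA.
    have ba := powers_malnormal_gen am a1 ab.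
    exists i, (f r^-1).
    have fp x y : powers x y ->
        powers (f x) (f y).
      by case=> n ->; exists n; rewrite morph_zpow.
    rewrite -(morphJ fM); apply/seteqP; split=> x; apply: powers_trans; exact: fp.
  move=> a b a1 b1 am bm; have [i [g aE]] := rep a a1 am.
  have [j [h ->]] := rep b b1 bm; have [t tE] := s_conj j i.
  have zE (l : class_reps G) : f (val l) = s l (k%:Z)%R.
    rewrite -[val l]zpow1 -[zpow _ _]/(vincl (s := root_star) l _) fE.
    by congr (s l _); exact: GRing.mul1r.
  (* Undo [g] to reach the image of [val i], pass to that of [val j] by [t], then apply [h]. *)
  exists (g^-1 * t * h); rewrite zE tE -zE -!conjgM.
  have [m mE] : powers (f (val i) ^ g)
      (f a) by rewrite -aE; exists 1%R.
  have [n nE] : powers (f a)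
      (f (val i) ^ g) by rewrite aE; exists 1%R.
  have iE : f (val i) ^ (t * h)
      = (f (val i) ^ g) ^ (g^-1 * t * h).
    by rewrite -conjgM !mulgA mulgV mul1g.
  rewrite iE; apply/seteqP; split=> x; apply: powers_trans; apply: powersJ.
    by exists n.
  by exists m.
Qed.

End RootExtension.

(** * The free group of rank 2 *)

Section EdgeLoops.
Variable D : star_of_groups.
Local Notation I := (hub_index D).

(** The loop that leaves the base vertex along edge [i] and returns along edge [j]. *)
Definition edge_loop (i j : I) : pi1 D := back j (cross i (base D)).

Lemma edge_loop_mul (x : pi1 D) i j : x * edge_loop i j = back j (cross i x).
Proof. by rewrite pi1M vpush_back hpush_cross -pi1M mulg1. Qed.

Lemma edge_loopii i : edge_loop i i = 1.
Proof. exact: crossK. Qed.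

Lemma edge_loopM i j l : edge_loop i j * edge_loop j l = edge_loop i l.
Proof. by rewrite edge_loop_mul backK. Qed.

Lemma edge_loopV i j : (edge_loop i j)^-1 = edge_loop j i.
Proof. by apply: mulg1_eq; rewrite edge_loopM edge_loopii. Qed.

Section Evaluation.
Variables (L : groupType) (h : I -> L).

(* The homomorphism that kills the vertex groups and sends the edge [i] to [h i]. *)
Fixpoint seq_val (v : seq (step D)) : L :=
  if v is (i, _, j, _) :: v' then seq_val v' * h i / h j else 1.

Definition loop_val (x : pi1 D) : L := seq_val (val x.1).

Definition hub_val (z : hframe D) : L :=
  seq_val (val z.1).1 * h (val z.1).2.1.

Lemma hub_val_cross i (w : vframe D) : hub_val (cross i w) = loop_val w * h i.
Proof.
case: w => [[v vP] g]; rewrite /hub_val /loop_val /= /cross_raw.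
case: v {vP} => [|[[[i' r'] j] m] v] //=.
by case: ifP => [/andP[/eqP-> _]|_] //=; rewrite mulgVK.
Qed.

Lemma loop_val_back i (z : hframe D) : loop_val (back i z) = hub_val z / h i.
Proof. by rewrite -[in RHS](backK i z) hub_val_cross mulgK. Qed.

Lemma loop_valM : {morph loop_val : x y / x * y}.
Proof.
move=> x [[v vP] g]; rewrite pi1M.
rewrite -[LHS]/(loop_val (follow v x)) -[loop_val (_, g)]/(seq_val v) {vP}.
elim: v => [|[[[i r] j] m] v IH] /=; first by rewrite mulg1.
by rewrite loop_val_back -[hub_val _]/(hub_val (cross i _)) hub_val_cross
  -[loop_val (vact _ _)]/(loop_val (follow v x)) IH !mulgA.
Qed.

Lemma loop_val_edge i j : loop_val (edge_loop i j) = h i / h j.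
Proof. by rewrite loop_val_back hub_val_cross /loop_val /= mul1g. Qed.

End Evaluation.

Variable i0 : I.
Hypotheses (vgroup1 : forall g : vgroup D, g = 1) (hub1 : forall n : hub D, n = 1).

Lemma edge_loop_ind (P : pi1 D -> Prop) : P 1 ->
  (forall x i j, P x -> P (x * edge_loop i j)) -> forall x, P x.
Proof.
move=> P1 PM x; rewrite -(mul1g x) pi1M.
have -> : vpush x (1 : pi1 D) = follow (val x.1) (base D).
  by rewrite /vpush (vgroup1 x.2) /vact mulg1; case: (follow _ _).
elim: (val x.1) => [|[[[i r] j] m] v IH] //=.
rewrite (hub1 m) (vgroup1 r) hact1.
have -> w : vact 1 w = w :> vframe D by rewrite /vact mulg1; case: w.
by rewrite -edge_loop_mul; apply: PM.
Qed.

Lemma edge_loops_free_basis :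
  free_basis [set: pi1 D] [set edge_loop i i0 | i in [set i | i <> i0]].
Proof.
split=> // L f; split.
  (* With value 1 on the edge [i0], the loop [edge_loop i i0] is sent to [h i]. Uniqueness holds
     since [edge_loop i j] is a quotient of two such loops. *)
  pose h i := if i == i0 then 1 else f (edge_loop i i0).
  exists (loop_val h); split=> [x y _ _|x]; first exact: loop_valM.
  rewrite inE => -[i /= /eqP/negbTE ne <-].
  by rewrite loop_val_edge /h eqxx ne divg1.
move=> phi psi phiM phiE psiM psiE x _.
have {}phiM : {morph phi : x y / x * y} by move=> u v; apply: phiM; rewrite inE.
have {}psiM : {morph psi : x y / x * y} by move=> u v; apply: psiM; rewrite inE.
have E0 i : phi (edge_loop i i0) = psi (edge_loop i i0).
  have [->|ne] := EM (i = i0); first by rewrite edge_loopii !morph1.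
  by rewrite phiE ?psiE // inE; exists i.
elim/edge_loop_ind: x => [|x i j IH]; first by rewrite !morph1.
rewrite phiM psiM IH -(edge_loopM i i0 j) -(edge_loopV j) phiM psiM.
by rewrite (morphV phiM) (morphV psiM) !E0.
Qed.

End EdgeLoops.

Definition triv : Type := unit.
HB.instance Definition _ := Countable.on triv.
Definition triv_mul (x y : triv) : triv := tt.
Definition triv_inv (x : triv) : triv := tt.
Lemma triv_mulA : associative triv_mul. Proof. by []. Qed.
Lemma triv_mul1l : left_id (tt : triv) triv_mul. Proof. by case. Qed.
Lemma triv_mul1r : right_id (tt : triv) triv_mul. Proof. by case. Qed.
Lemma triv_mulV : left_inverse (tt : triv) triv_inv triv_mul. Proof. by []. Qed.
Lemma triv_Vmul : right_inverse (tt : triv) triv_inv triv_mul. Proof. by []. Qed.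
HB.instance Definition _ := isGroup.Build triv
  triv_mulA triv_mul1l triv_mul1r triv_mulV triv_Vmul.

Lemma triv_eq (x y : triv) : x = y. Proof. by case: x; case: y. Qed.

Lemma triv_homM : {morph (fun c : triv => c) : x y / x * y}.
Proof. by []. Qed.

Lemma triv_hom_inj : injective (fun c : triv => c).
Proof. by []. Qed.

(* Two vertices joined by three edges: the fundamental group is free of rank 2. *)
Definition theta_graph : star_of_groups :=
  @StarOfGroups 'I_3 triv triv triv (fun _ c => c) (fun c => c)
    (fun _ => triv_homM) triv_homM (fun _ => triv_hom_inj) triv_hom_inj.

Definition free2 : groupType := pi1 theta_graph.

Lemma free2_free : exists X, free_basis [set: free2] X.
Proof.
by eexists; apply: (@edge_loops_free_basis theta_graph ord0) => x; apply: triv_eq.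
Qed.

Lemma free2_cyclic_CSA : cyclic_CSA free2.
Proof.
apply: pi1_cyclic_CSA.
- by move=> g []; apply: triv_eq.
- by move=> i j g c d []; apply: triv_eq.
- by exists 1 => n; exists 0%R; apply: triv_eq.
- by move=> x n _; apply: triv_eq.
Qed.

Lemma free2_noncommutative : exists x y : free2, x * y <> y * x.
Proof.
pose a : 'I_3 := ord0; pose b : 'I_3 := lift ord0 ord0; pose c : 'I_3 := ord_max.
(* The two loops are sent to the non-commuting transpositions (a b) and (b c) of the symmetric group
   on three points. *)
pose h (i : 'I_3) : {perm 'I_3} :=
  if i == a then 1 else if i == b then tperm a b else tperm b c.
exists (@edge_loop theta_graph b a), (@edge_loop theta_graph c a).
move/(congr1 (@loop_val theta_graph _ h)).
rewrite !loop_valM !loop_val_edge /h !eqxx /= invg1 !mulg1.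
move/(congr1 (fun s : {perm 'I_3} => s a)); rewrite !permM.
by rewrite tpermL tpermL (tpermD (x := b)) // tpermL.
Qed.

Lemma free2_countable : countable [set: free2].
Proof.
apply/countable_injP.
exists (fun x => pickle (val x.1 : seq ('I_3 * triv * 'I_3 * triv))).
move=> [v g] [v' g'] _ _ /= /(pcan_inj pickleK)/val_inj->.
by rewrite (triv_eq g g').
Qed.

(** * Direct limits *)

Record tower := Tower {
  level : nat -> groupType;
  up : forall n, level n -> level n.+1;
  upM : forall n, {morph @up n : x y / x * y};
  up_inj : forall n, injective (@up n)
}.

(** The induction shifts the whole family of groups, which avoids transport between equal levels.
    Values below [n] are arbitrary. *)
Lemma thread_through (G : nat -> groupType) (f : forall n, G n -> G n.+1) n (x : G n) :
  exists s : forall m, G m, s n = x /\ forall m, (n <= m)%N -> s m.+1 = f m (s m).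
Proof.
elim: n G f x => [|n IH] G f x.
  by exists (nat_rect (fun m => G m) x f); split.
have [s [sn sE]] := IH (fun m => G m.+1) (fun m => f m.+1) x.
exists (fun m => if m is m'.+1 then s m' else 1); split=> //.
by case=> [|m] //; apply: sE.
Qed.

Section DirectLimit.
Local Open Scope quotient_scope.
Variable T : tower.
Local Notation L := (level T).

Definition compatible_from (s : forall n, L n) N : Prop :=
  forall n, (N <= n)%N -> s n.+1 = up (s n).

(** The limit consists of eventually compatible sequences modulo eventual equality, so that its
    operations are pointwise. *)
Definition thread := {classic {s : forall n, L n | exists N, compatible_from s N}}.
Implicit Types s t u : thread.

Definition ev_eq s t : bool :=
  `[< exists N, forall n, (N <= n)%N -> sval s n = sval t n >].

Lemma ev_eq_refl : reflexive ev_eq.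
Proof. by move=> s; apply/asboolP; exists 0%N. Qed.

Lemma ev_eq_sym : symmetric ev_eq.
Proof.
by move=> s t; apply/asboolP/asboolP => -[N e]; exists N => n /e.
Qed.

Lemma ev_eq_trans : transitive ev_eq.
Proof.
move=> t s u /asboolP[M e] /asboolP[N e']; apply/asboolP; exists (maxn M N) => n.
by rewrite geq_max => /andP[/e-> /e'].
Qed.

Canonical ev_equiv := EquivRel ev_eq ev_eq_refl ev_eq_sym ev_eq_trans.

Definition limit : Type := {eq_quot ev_equiv}.
HB.instance Definition _ := Choice.on limit.

Definition germ s : limit := \pi_({eq_quot ev_equiv}) s.

Lemma germ_eq s t : germ s = germ t <->
  exists N, forall n, (N <= n)%N -> sval s n = sval t n.
Proof.
split=> [/eqmodP/asboolP//|e]; exact/eqmodP/asboolP.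
Qed.

Lemma germ_surj (a : limit) : exists s, a = germ s.
Proof. by exists (repr a); rewrite /germ reprK. Qed.

Definition thread_one : thread :=
  exist _ (fun n => 1) (ex_intro _ 0%N (fun n _ => esym (morph1 (@upM T n)))).

Lemma thread_mul_subproof s t :
  exists N, compatible_from (fun n => sval s n * sval t n) N.
Proof.
case: s t => [s [M sM]] [t [N tN]] /=; exists (maxn M N) => n.
by rewrite geq_max upM => /andP[/sM-> /tN->].
Qed.

Definition thread_mul s t : thread := exist _ _ (thread_mul_subproof s t).

Lemma thread_inv_subproof s : exists N, compatible_from (fun n => (sval s n)^-1) N.
Proof.
by case: s => [s [M sM]] /=; exists M => n /sM->; rewrite (morphV (@upM T n)).
Qed.

Definition thread_inv s : thread := exist _ _ (thread_inv_subproof s).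

Definition limit_one : limit := germ thread_one.
Definition limit_mul (a b : limit) : limit :=
  germ (thread_mul (repr (a : {eq_quot ev_equiv})) (repr (b : {eq_quot ev_equiv}))).
Definition limit_inv (a : limit) : limit :=
  germ (thread_inv (repr (a : {eq_quot ev_equiv}))).

Lemma germ_repr s : exists N, forall n, (N <= n)%N ->
  sval (repr (germ s : {eq_quot ev_equiv})) n = sval s n.
Proof. by apply/germ_eq; rewrite /germ reprK. Qed.

Lemma germM s t : limit_mul (germ s) (germ t) = germ (thread_mul s t).
Proof.
have [M sM] := germ_repr s; have [N tN] := germ_repr t.
apply/germ_eq; exists (maxn M N) => n; rewrite geq_max => /andP[Mn Nn] /=.
by rewrite sM // tN.
Qed.

Lemma germV s : limit_inv (germ s) = germ (thread_inv s).
Proof.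
have [M sM] := germ_repr s.
by apply/germ_eq; exists M => n Mn /=; rewrite sM.
Qed.

Lemma limit_mulA : associative limit_mul.
Proof.
move=> a b c; have [s ->] := germ_surj a; have [t ->] := germ_surj b.
have [u ->] := germ_surj c; rewrite !germM; apply/germ_eq.
by exists 0%N => n _ /=; rewrite mulgA.
Qed.

Lemma limit_mul1l : left_id limit_one limit_mul.
Proof.
move=> a; have [s ->] := germ_surj a; rewrite germM; apply/germ_eq.
by exists 0%N => n _ /=; rewrite mul1g.
Qed.

Lemma limit_mul1r : right_id limit_one limit_mul.
Proof.
move=> a; have [s ->] := germ_surj a; rewrite germM; apply/germ_eq.
by exists 0%N => n _ /=; rewrite mulg1.
Qed.

Lemma limit_mulV : left_inverse limit_one limit_inv limit_mul.
Proof.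
move=> a; have [s ->] := germ_surj a; rewrite germV germM; apply/germ_eq.
by exists 0%N => n _ /=; rewrite mulVg.
Qed.

Lemma limit_Vmul : right_inverse limit_one limit_inv limit_mul.
Proof.
move=> a; have [s ->] := germ_surj a; rewrite germV germM; apply/germ_eq.
by exists 0%N => n _ /=; rewrite mulgV.
Qed.

HB.instance Definition _ := isGroup.Build limit
  limit_mulA limit_mul1l limit_mul1r limit_mulV limit_Vmul.

Lemma compatible_eq (s t : forall n, L n) n : compatible_from s n ->
  compatible_from t n -> s n = t n -> forall m, (n <= m)%N -> s m = t m.
Proof.
move=> sn tn e m; elim: m => [|m IH]; first by rewrite leqn0 => /eqP<-.
rewrite leq_eqVlt => /orP[/eqP<- //|nm].
by rewrite sn // tn // IH.
Qed.

Lemma compatible_inj (s t : forall n, L n) n : compatible_from s n ->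
  compatible_from t n -> forall m, (n <= m)%N -> s m = t m -> s n = t n.
Proof.
move=> sn tn m nm; rewrite -(subnKC nm); elim: (m - n)%N => [|k IH].
  by rewrite addn0.
by rewrite addnS sn ?leq_addr // tn ?leq_addr // => /up_inj/IH.
Qed.

Lemma thread_at n (x : L n) : exists s, sval s n = x /\ compatible_from (sval s) n.
Proof.
have [s [sn sE]] := @thread_through L (@up T) n x.
by exists (exist _ s (ex_intro _ n sE)).
Qed.

Definition to_limit n (x : L n) : limit := germ (projT1 (cid (thread_at x))).

Lemma to_limitE n (x : L n) : exists s,
  [/\ to_limit x = germ s, sval s n = x & compatible_from (sval s) n].
Proof. by rewrite /to_limit; case: cid => s [sn sc] /=; exists s. Qed.

Lemma to_limitM n : {morph @to_limit n : x y / x * y}.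
Proof.
move=> x y; have [s [-> sn sc]] := to_limitE (x * y).
have [t [-> tn tc]] := to_limitE x; have [u [-> un uc]] := to_limitE y.
rewrite [RHS]germM; apply/germ_eq; exists n.
apply: compatible_eq => //=; last by rewrite sn tn un.
by move=> m nm; rewrite tc // uc // upM.
Qed.

Lemma to_limit_inj n : injective (@to_limit n).
Proof.
move=> x y; have [s [-> <- sc]] := to_limitE x; have [t [-> <- tc]] := to_limitE y.
case/germ_eq => N e; apply: (compatible_inj sc tc (leq_maxl n N)).
by apply: e; exact: leq_maxr.
Qed.

Lemma to_limit_up n (x : L n) : to_limit (up x) = to_limit x.
Proof.
have [s [-> sn sc]] := to_limitE (up x); have [t [-> tn tc]] := to_limitE x.
apply/germ_eq; exists n.+1; apply: compatible_eq => //.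
  by move=> m nm; apply: tc; apply: ltnW.
by rewrite sn tc // tn.
Qed.

Lemma to_limit_surj (a : limit) : exists n (x : L n), a = to_limit x.
Proof.
have [s ->] := germ_surj a; have [n sc] := projT2 s.
exists n, (sval s n); have [t [-> tn tc]] := to_limitE (sval s n).
by apply/germ_eq; exists n; apply: compatible_eq.
Qed.

End DirectLimit.

(** * Subgroups of the limit *)

Lemma powers_subgroup (G : groupType) (a : G) : is_subgroup (powers a).
Proof.
split; first by rewrite inE; exists 0%R.
by move=> x y; rewrite !inE => -[m ->] [n ->]; exists (m - n)%R; rewrite zpowD zpowN.
Qed.

Lemma powers_abelian (G : groupType) (a : G) : is_abelian (powers a).
Proof. by move=> x y; rewrite !inE => -[m ->] [n ->]; rewrite zpow_comm. Qed.

Lemma conj_set_powers (G : groupType) (a g : G) :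
  conj_set (powers a) g = powers (a ^ g).
Proof.
apply/seteqP; split=> x /=; first by case=> _ [n ->] <-; exists n; rewrite zpowJ.
by case=> n ->; exists (zpow a n); [exists n | rewrite zpowJ].
Qed.

Lemma image_powers (G H : groupType) (f : G -> H) (a : G) :
  {morph f : x y / x * y} -> f @` powers a = powers (f a).
Proof.
move=> fM; apply/seteqP; split=> x /=.
  by case=> _ [n ->] <-; exists n; rewrite morph_zpow.
by case=> n ->; exists (zpow a n); [exists n | rewrite morph_zpow].
Qed.

Lemma max_abelian_neq1 (G : groupType) (H A : set G) x : max_abelian H A ->
  x <> 1 -> powers x `<=` H -> exists2 y, A y & y <> 1.
Proof.
case=> -[A1 _] _ _ Amax x1 xH.
have [//|A0] := EM (exists2 y, A y & y <> 1); exfalso; apply: x1.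
have /Amax e := powers_subgroup x.
have: A x by rewrite -e ?/is_abelian //; [exists 1%R | exact: powers_abelian |
  move=> y Ay; have [->|y1] := EM (y = 1); [exists 0%R | case: A0; exists y]].
by move=> Ax; apply/not_notP => x1; apply: A0; exists x.
Qed.

(** The malnormal cyclic subgroup around [y] contains [y'], [a] and [g]. Involving four elements
    only, the statement passes to the limit; [y' = y] gives transitivity of commutation, and the
    general case malnormality of centralizers. *)
Lemma cyclic_CSA_commute (G : groupType) (y y' a g : G) : cyclic_CSA G ->
  y <> 1 -> y * y' = y' * y -> y * a = a * y -> y' ^ g = y -> a * g = g * a.
Proof.
move=> Gcsa y1 yy' ya y'g; have [d dy dm] := Gcsa.2 y y1.
have dy' := powers_fix dm dy y1 yy'.
have [m ->] := powers_fix dm dy y1 ya.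
have [||n ->] := dm g y' _ dy'; rewrite ?y'g //; last by rewrite zpow_comm.
by move=> e; apply: y1; rewrite -y'g e conj1g.
Qed.

Section Image.
Variables (K G : groupType) (f : K -> G).
Hypotheses (fM : {morph f : x y / x * y}) (f_inj : injective f).
Hypotheses (Kcsa : cyclic_CSA K) (K1 : exists x : K, x <> 1).

Lemma range_subgroup : is_subgroup (range f).
Proof.
split; first by rewrite inE; exists 1; rewrite ?(morph1 fM).
move=> x y; rewrite !inE => -[u _ <-] [v _ <-]; exists (u * v^-1) => //.
by rewrite fM (morphV fM).
Qed.

Lemma range_torsion_free : torsion_free (range f).
Proof.
move=> _ /set_mem[x _ <-] [|n] // _; rewrite -[_ ^+ _]/(zpow (f x) n.+1).
rewrite -morph_zpow // -(morph1 fM) => /f_inj/Kcsa.1->.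
by rewrite (morph1 fM).
Qed.

(** [A] has a nontrivial element [f x]; all that commutes with it lies in the image of the malnormal
    cyclic subgroup around [x], and maximality gives equality. *)
Lemma range_max_abelian A : max_abelian (range f) A ->
  exists a, [/\ a <> 1, powers_malnormal a & A = powers (f a)].
Proof.
move=> Amax; have [x0 x01] := K1.
have pr a : powers (f a) `<=` range f.
  by rewrite -image_powers //; apply: image_subset.
have [|y Ay y1] := max_abelian_neq1 Amax _ (pr x0).
  by rewrite -(morph1 fM) => /f_inj.
case: Amax => Asub Aab Ar Amax.
have [x _ xy] := Ar y Ay; subst y.
have x1 : x <> 1 by move=> e; apply: y1; rewrite e (morph1 fM).
have [a [n xE] am] := Kcsa.2 x x1; exists a; split=> //.
  by move=> a1; apply: x1; rewrite xE a1 zpow1n.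
apply/esym/Amax; [exact: powers_subgroup | exact: powers_abelian | exact: pr |].
move=> z Az; have [u _ uz] := Ar z Az; subst z.
rewrite -image_powers //; exists u => //; apply: (powers_fix am) x1 _.
  by exists n.
by apply: f_inj; rewrite !fM; apply: Aab; rewrite inE.
Qed.

Lemma range_CSA : CSA (range f).
Proof.
move=> A /range_max_abelian[a [a1 am ->]] _ /set_mem[g _ <-] ne.
(* The intersection contains 1, so to differ from [[set 1]] it must have a nontrivial element. *)
have [z [az [y ay yz]] z1] : exists2 z,
    (powers (f a) `&` conj_set (powers (f a)) (f g)) z & z <> 1.
  have [//|no] := EM (exists2 z,
    (powers (f a) `&` conj_set (powers (f a)) (f g)) z & z <> 1).
  case: ne; apply/seteqP; split=> z /= zP.
    by apply/not_notP => z1; apply: no; exists z.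
  rewrite zP; split; first by exists 0%R.
  by exists 1; [exists 0%R | rewrite conj1g].
move: az ay; rewrite inE -!image_powers // => -[u au uz] [v av vy].
exists g => //; apply: (am _ v) => //.
  by move=> v1; apply: z1; rewrite -yz -vy v1 (morph1 fM) conj1g.
have -> // : v ^ g = u.
by apply: f_inj; rewrite uz -yz -vy (morphJ fM).
Qed.

Lemma range_free_basis X : free_basis [set: K] X -> free_basis (range f) (f @` X).
Proof.
case=> _ Xfree; split; first exact: image_subset.
move=> L h; have [[phi [phiM phiE]] uniq_hom] := Xfree L (h \o f).
(* [r] inverts [f] on its range and takes the default value 1 elsewhere. *)
pose r y := xget 1 [set x | f x = y].
have rK x : r (f x) = x.
  by apply: f_inj; rewrite (@xgetPex _ 1 [set x' | f x' = f x]) //; exists x.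
split.
  exists (phi \o r); split=> [x y|_ /set_mem[x Xx <-]] /=.
    move=> /set_mem[u _ <-] /set_mem[v _ <-].
    by rewrite -fM !rK phiM ?inE.
  by rewrite rK phiE ?inE.
move=> phi' psi' pM pE qM qE _ /set_mem[x _ <-].
apply: (uniq_hom (phi' \o f) (psi' \o f)); rewrite ?inE //=.
- by move=> u v _ _ /=; rewrite fM pM ?inE.
- by move=> u /set_mem Xu /=; rewrite pE // inE; exists u.
- by move=> u v _ _ /=; rewrite fM qM ?inE.
- by move=> u /set_mem Xu /=; rewrite qE // inE; exists u.
Qed.

End Image.

(** * The tower of root extensions *)

Record csa_group := CsaGroup {
  csa_carrier : groupType;
  csa_carrierP : cyclic_CSA csa_carrier
}.

Definition root_embedding k (G H : groupType) (f : G -> H) : Prop :=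
  [/\ {morph f : x y / x * y}, injective f,
      forall x, exists y, y ^+ k = f x &
      forall a b, a <> 1 -> b <> 1 -> powers_malnormal a -> powers_malnormal b ->
        exists g, powers (f b) = powers (f a ^ g)].

Lemma next_csa_ex k (X : csa_group) :
  exists Y : csa_group, exists f : csa_carrier X -> csa_carrier Y, root_embedding k.+1 f.
Proof.
have [H [f [fM f_inj Hcsa roots conj]]] := root_extension (csa_carrierP X) (ltn0Sn k).
by exists (CsaGroup Hcsa), f.
Qed.

Definition next_csa k X := projT1 (cid (next_csa_ex k X)).
Definition next_map k X : csa_carrier X -> csa_carrier (next_csa k X) :=
  projT1 (cid (projT2 (cid (next_csa_ex k X)))).

Lemma next_mapP k X : root_embedding k.+1 (@next_map k X).
Proof. exact: (projT2 (cid (projT2 (cid (next_csa_ex k X))))). Qed.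

(* Indexing: the group at level [n] is the paper's group with index [n + 1]. *)
Fixpoint csa_level n : csa_group :=
  if n is n'.+1 then next_csa n'.+1 (csa_level n') else CsaGroup free2_cyclic_CSA.

Definition csa_up n : csa_carrier (csa_level n) -> csa_carrier (csa_level n.+1) :=
  @next_map n.+1 (csa_level n).

(** Level [n] has index [n + 1], so the next level, of index [n + 2], adds roots of that order. *)
Lemma csa_upP n : root_embedding n.+2 (@csa_up n).
Proof. exact: next_mapP. Qed.

Lemma csa_upM n : {morph @csa_up n : x y / x * y}.
Proof. by case: (csa_upP n). Qed.

Lemma csa_up_inj n : injective (@csa_up n).
Proof. by case: (csa_upP n). Qed.

Definition csa_tower : tower := Tower csa_upM csa_up_inj.

Definition csa_limit : groupType := limit csa_tower.
Definition csa_incl n : csa_carrier (csa_level n) -> csa_limit :=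
  @to_limit csa_tower n.
Definition csa_stage n : set csa_limit := range (@csa_incl n).

Lemma csa_inclM n : {morph @csa_incl n : x y / x * y}.
Proof. exact: (@to_limitM csa_tower n). Qed.

Lemma csa_incl_inj n : injective (@csa_incl n).
Proof. exact: (@to_limit_inj csa_tower n). Qed.

Lemma csa_incl_up n x : csa_incl (@csa_up n x) = csa_incl x.
Proof. exact: (@to_limit_up csa_tower). Qed.

Lemma csa_level_CSA n : cyclic_CSA (csa_carrier (csa_level n)).
Proof. exact: csa_carrierP. Qed.

Lemma csa_level_neq1 n : exists x : csa_carrier (csa_level n), x <> 1.
Proof.
elim: n => [|n [x x1]]; last first.
  by exists (csa_up x); rewrite -(morph1 (@csa_upM n)) => /csa_up_inj.
have [x [y xy]] := free2_noncommutative; exists x => x1.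
by apply: xy; rewrite x1 mul1g mulg1.
Qed.

Lemma csa_stageS n : csa_stage n `<=` csa_stage n.+1.
Proof. by move=> _ [x _ <-]; exists (csa_up x) => //; apply: csa_incl_up. Qed.

Lemma csa_stage_le m n : (m <= n)%N -> csa_stage m `<=` csa_stage n.
Proof.
move=> mn; rewrite -(subnKC mn); elim: (n - m)%N => [|k IH]; first by rewrite addn0.
by rewrite addnS => x /IH; apply: csa_stageS.
Qed.

Lemma csa_stage_ex (x : csa_limit) : exists n, csa_stage n x.
Proof. by have [n [y ->]] := to_limit_surj x; exists n, y. Qed.

Lemma csa_stage_conj n A B : max_abelian (csa_stage n) A ->
  max_abelian (csa_stage n) B -> conjugate_in (csa_stage n.+1) A B.
Proof.
have max C := range_max_abelian (@csa_inclM n) (@csa_incl_inj n)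
  (csa_level_CSA n) (csa_level_neq1 n) (A := C).
move=> /max[a [a1 am ->]] /max[b [b1 bm ->]].
have [_ _ _ conj] := csa_upP n; have [g gE] := conj a b a1 b1 am bm.
exists (@csa_incl n.+1 g); first by rewrite inE; exists g.
have fM := @csa_inclM n.+1.
rewrite conj_set_powers -(csa_incl_up a) -(csa_incl_up b) -(morphJ fM).
by rewrite -!(image_powers _ fM) gE.
Qed.

Lemma csa_stage_root n x : csa_stage n x -> exists2 y, csa_stage n.+1 y & y ^+ n.+2 = x.
Proof.
case=> u _ <-; have [_ _ roots _] := csa_upP n; have [y yE] := roots u.
exists (@csa_incl n.+1 y); first by exists y.
rewrite -[_ ^+ _]/(zpow _ n.+2) -morph_zpow; last exact: csa_inclM.
by rewrite /= yE csa_incl_up.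
Qed.

Lemma csa_limit_commute (y y' a g : csa_limit) :
  y <> 1 -> y * y' = y' * y -> y * a = a * y -> y' ^ g = y -> a * g = g * a.
Proof.
have [n1 y1] := csa_stage_ex y; have [n2 y2] := csa_stage_ex y'.
have [n3 a3] := csa_stage_ex a; have [n4 g4] := csa_stage_ex g.
pose n := (n1 + n2 + n3 + n4)%N.
have {y1}[y1 _ <-] : csa_stage n y by apply: csa_stage_le y1; rewrite /n; lia.
have {y2}[y2 _ <-] : csa_stage n y' by apply: csa_stage_le y2; rewrite /n; lia.
have {a3}[a3 _ <-] : csa_stage n a by apply: csa_stage_le a3; rewrite /n; lia.
have {g4}[g4 _ <-] : csa_stage n g by apply: csa_stage_le g4; rewrite /n; lia.
have fM := @csa_inclM n; have f_inj := @csa_incl_inj n.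
move=> ne; rewrite -!fM => /f_inj e1 /f_inj e2 e3; congr csa_incl.
apply: (cyclic_CSA_commute (csa_level_CSA n) _ e1 e2).
  by move=> e; apply: ne; rewrite e (morph1 fM).
by apply: f_inj; rewrite -e3 (morphJ fM).
Qed.

(** * Maximal abelian subgroups of the union *)

Definition centralizer (G : groupType) (y : G) : set G := [set x | y * x = x * y].

Lemma centralizer_subgroup (G : groupType) (y : G) : is_subgroup (centralizer y).
Proof.
split; first by rewrite inE /centralizer /= mul1g mulg1.
move=> u v; rewrite !inE /centralizer /= => uy vy; rewrite mulgA uy -!mulgA.
by congr (_ * _); apply: (mulIg v); rewrite mulgVK -mulgA vy mulKg.
Qed.

Lemma conj_set_centralizer (G : groupType) (y g : G) :
  conj_set (centralizer y) g = centralizer (y ^ g).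
Proof.
apply/seteqP; split=> x; rewrite /centralizer /=.
  by case=> u uy <-; rewrite -!conjMg uy.
move=> xy; exists (x ^ g^-1); last by rewrite conjgKV.
by apply: (@conjg_inj _ g); rewrite [LHS]conjMg [RHS]conjMg conjgKV.
Qed.

(** The centralizer of [y] contains [A] and is abelian by transitivity of commutation. *)
Lemma csa_limit_max_abelian A y : max_abelian [set: csa_limit] A ->
  A y -> y <> 1 -> A = centralizer y.
Proof.
case=> _ Aab _ Amax Ay y1; apply/esym/Amax => //.
- exact: centralizer_subgroup.
- move=> u v; rewrite !inE /centralizer /= => uy vy.
  by apply: (csa_limit_commute y1 (erefl _) uy); rewrite conjgE vy mulKg.
- by move=> u Au; apply: Aab; rewrite inE.
Qed.

Lemma csa_limit_max_abelian_neq1 A : max_abelian [set: csa_limit] A ->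
  exists2 y, A y & y <> 1.
Proof.
have [x x1] := csa_level_neq1 0.
move=> Amax; apply: (@max_abelian_neq1 _ _ _ (csa_incl x) Amax) => //.
by rewrite -(morph1 (@csa_inclM 0)) => /csa_incl_inj.
Qed.

Lemma csa_limit_CSA : CSA [set: csa_limit].
Proof.
move=> A Amax g _ ne.
have [z [Az [y Ay yz]] z1] : exists2 z, (A `&` conj_set A g) z & z <> 1.
  have [//|no] := EM (exists2 z, (A `&` conj_set A g) z & z <> 1).
  have A1 : A 1 by case: Amax => -[]; rewrite inE.
  case: ne; apply/seteqP; split=> z /= zP.
    by apply/not_notP => z1; apply: no; exists z.
  by rewrite zP; split=> //; exists 1; rewrite ?conj1g.
have AE := csa_limit_max_abelian Amax Az z1.
rewrite inE AE /centralizer /=; apply: (csa_limit_commute z1 _ (erefl _) yz).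
by move: Ay; rewrite AE.
Qed.

(** [A] and [B] are centralizers of generators [a], [b] of malnormal cyclic subgroups of one stage.
    The next stage conjugates these subgroups, so [a ^ g] is a nontrivial element of [B] and its
    centralizer is [B]. *)
Lemma csa_limit_conj A B : max_abelian [set: csa_limit] A ->
  max_abelian [set: csa_limit] B -> conjugate_in [set: csa_limit] A B.
Proof.
move=> Amax Bmax.
have [y Ay y1] := csa_limit_max_abelian_neq1 Amax.
have [w Bw w1] := csa_limit_max_abelian_neq1 Bmax.
have [m ym] := csa_stage_ex y; have [n wn] := csa_stage_ex w.
pose p := maxn m n; have fM := @csa_inclM p.
have {ym}[y' _ yE] : csa_stage p y := csa_stage_le (leq_maxl m n) ym.
have {wn}[w' _ wE] : csa_stage p w := csa_stage_le (leq_maxr m n) wn.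
have gen x (x' : csa_carrier (csa_level p)) C : max_abelian [set: csa_limit] C -> C x ->
    x <> 1 -> csa_incl x' = x -> exists a : csa_carrier (csa_level p),
    [/\ a <> 1, powers_malnormal a & C = centralizer (csa_incl a)].
  move=> Cmax Cx x1 xE.
  have x'1 : x' <> 1 by move=> e; apply: x1; rewrite -xE e (morph1 fM).
  have [a [k aE] am] := (csa_level_CSA p).2 x' x'1; exists a.
  have a1 : a <> 1 by move=> e; apply: x'1; rewrite aE e zpow1n.
  split=> //; apply: (csa_limit_max_abelian Cmax); last first.
    by rewrite -(morph1 fM) => /csa_incl_inj.
  rewrite (csa_limit_max_abelian Cmax Cx x1) /centralizer /= -xE -!fM aE.
  by rewrite -{2 3}(zpow1 a) zpow_comm.
have [a [a1 am AE]] := gen y y' A Amax Ay y1 yE.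
have [b [b1 bm BE]] := gen w w' B Bmax Bw w1 wE.
have [_ _ _ conj] := csa_upP p; have [g gE] := conj a b a1 b1 am bm.
exists (@csa_incl p.+1 g); first by rewrite inE.
have f'M := @csa_inclM p.+1.
have ab1 : csa_up a ^ g <> 1.
  by move=> /eqP; rewrite conjg_eq1 -(morph1 (@csa_upM p)) => /eqP/csa_up_inj.
rewrite AE conj_set_centralizer -(csa_incl_up a) -(morphJ f'M).
apply: (csa_limit_max_abelian Bmax); last first.
  by rewrite -(morph1 f'M) => /csa_incl_inj.
have [k ->] : powers (csa_up b) (csa_up a ^ g) by rewrite gE; exists 1%R.
rewrite BE /centralizer /= -csa_incl_up -!f'M; congr csa_incl.
by rewrite -{1 4}(zpow1 (csa_up b)) zpow_comm.
Qed.

Lemma csa_limit_divisible A : max_abelian [set: csa_limit] A -> divisible A.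
Proof.
move=> Amax [//|n] _ x /set_mem Ax.
have [->|x1] := EM (x = 1).
  by exists 1; [case: Amax => -[] | rewrite expg1n].
(* [i] satisfies [i + 2 = (j + 2) * (n + 1)] and [i >= j]: stage [i] contains [x], and the next one
   a root [y] of order [i + 2]. Then [y ^+ j.+2] is the required root; as a power of [y] it commutes
   with [x]. *)
have [j xj] := csa_stage_ex x; pose i := (n.+1 * j.+2 - 2)%N.
have [y _ yE] : exists2 y, csa_stage i.+1 y & y ^+ i.+2 = x.
  by apply: csa_stage_root; apply: csa_stage_le xj; rewrite /i; nia.
have iE : i.+2 = (j.+2 * n.+1)%N by rewrite /i; nia.
exists (y ^+ j.+2); last by rewrite -expgnA -iE.
rewrite inE (csa_limit_max_abelian Amax Ax x1) /centralizer /= -yE.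
by rewrite -!expgnDr addnC.
Qed.

Theorem mainTheorem1 :
  exists (G : groupType) (Gs : nat -> set G),
    (forall k, (1 <= k)%N -> is_subgroup (Gs k)) /\
    (forall k, (1 <= k)%N -> Gs k `<=` Gs k.+1) /\
    (is_free (Gs 1%N) /\ countable (Gs 1%N) /\ ~ is_abelian (Gs 1%N)) /\
    (forall k, (1 <= k)%N ->
       [/\ torsion_free (Gs k), CSA (Gs k) &
           forall A, max_abelian (Gs k) A -> is_cyclic A]) /\
    (forall k, (2 <= k)%N ->
       (forall A B, max_abelian (Gs k.-1) A -> max_abelian (Gs k.-1) B ->
          conjugate_in (Gs k) A B) /\
       {in Gs k.-1, forall x, exists2 y, y \in Gs k & y ^+ k = x}) /\
    \bigcup_(k in [set k : nat | (1 <= k)%N]) Gs k = [set: G] /\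
    [/\ torsion_free [set: G], ~ is_abelian [set: G] & CSA [set: G]] /\
    (forall A B, max_abelian [set: G] A -> max_abelian [set: G] B ->
       conjugate_in [set: G] A B) /\
    (forall A, max_abelian [set: G] A -> divisible A).
Proof.
have stageM n := @csa_inclM n; have stage_inj n := @csa_incl_inj n.
have nonab (H : set csa_limit) : csa_stage 0 `<=` H -> ~ is_abelian H.
  move=> sub ab; have [x [y xy]] := free2_noncommutative; apply: xy.
  apply: (stage_inj 0%N); rewrite !stageM.
  by apply: ab; rewrite inE; apply: sub; [exists x | exists y].
(* Indices are shifted by one; index 0 lies outside the chain and gets the empty set. *)
exists csa_limit, (fun k => if k is n.+1 then csa_stage n else set0).
split; [|split; [|split; [|split; [|split; [|split; [|split; [|split]]]]]]].
- by case=> // n _; apply: range_subgroup.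
- by case=> // n _; apply: csa_stageS.
- split; [|split]; last exact: nonab.
    have [X Xfree] := free2_free; exists (@csa_incl 0 @` X).
    exact: (range_free_basis (stageM 0%N) (stage_inj 0%N) Xfree).
  exact: sub_countable (card_image_le _ _) free2_countable.
- case=> // n _; have Kcsa := csa_level_CSA n; have K1 := csa_level_neq1 n; split.
  + exact: range_torsion_free.
  + exact: range_CSA.
  + move=> A /(range_max_abelian (stageM n) (stage_inj n) Kcsa K1)[a [_ _ ->]].
    exact: powers_cyclic.
- case=> [|[|n]] // _; split; first exact: csa_stage_conj.
  move=> x /set_mem/csa_stage_root[y yP yE]; exists y => //.
  by rewrite inE.
- apply/seteqP; split=> // x _; have [n xn] := csa_stage_ex x.
  by exists n.+1.
- split; [|exact: nonab|exact: csa_limit_CSA].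
  move=> x _ n n1 xn; have [m xm] := csa_stage_ex x.
  by apply: (range_torsion_free (stageM m) (stage_inj m) (csa_level_CSA m) _ n1 xn);
     rewrite inE.
- exact: csa_limit_conj.
- exact: csa_limit_divisible.
Qed.
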